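(* Let $N\ge 3$. The optimal Hardy constant of the cones $\mathcal{C}_\gamma\subset\mathbb{R}^N$ satisfies $$\lim_{\gamma\to\pi/2}\mu(\mathcal{C}_\gamma)=\mu(\mathcal{C}_{\pi/2})=\frac{N^2}{4}.$$
   Context: For $0<\gamma<\pi$, $\mathcal{C}_\gamma=\{x\in\mathbb{R}^N\setminus\{0\} : x_N>|x|\cos\gamma\}$ is the circular cone with vertex $0$, axis the positive $x_N$-axis and slot $\gamma$. For an open set $\Omega\subset\mathbb{R}^N$ with $0\in\partial\Omega$, $\mu(\Omega)$ is the best constant in the Hardy inequality: $$\mu(\Omega)=\inf\Big\{\int_\Omega|\nabla u|^2\,dx\Big/\int_\Omega\frac{u^2}{|x|^2}\,dx \ :\ u\in H_0^1(\Omega),\ u\neq0\Big\}.$$ *)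

(* Defs.v *)
From HB Require Import structures.
From mathcomp Require Import all_boot all_order all_algebra.
From mathcomp Require Import all_classical all_reals all_analysis.

Set Implicit Arguments.
Unset Strict Implicit.
Unset Printing Implicit Defensive.
Import Order.TTheory GRing.Theory Num.Theory.
Import numFieldNormedType.Exports.
Local Open Scope classical_set_scope.
Local Open Scope ring_scope.

Fact rV_display : measure_display. Proof. exact: default_measure_display. Qed.

Section measurable_rV.
Variables (R : realType) (n : nat).

(* Product sigma-algebra on R^n, generated by the coordinates; it is the Borel
   sigma-algebra. *)
Definition rV_coord (i : 'I_n) (x : 'rV[R]_n) : measurableTypeR R := x 0 i.

Let rV_set0 : g_sigma_preimage rV_coord set0.
Proof. exact: sigma_algebra0. Qed.

Let rV_setC A : g_sigma_preimage rV_coord A -> g_sigma_preimage rV_coord (~` A).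
Proof. exact: sigma_algebraC. Qed.

Let rV_bigcup (F : (set 'rV[R]_n)^nat) :
  (forall i, g_sigma_preimage rV_coord (F i)) ->
  g_sigma_preimage rV_coord (\bigcup_i (F i)).
Proof. exact: sigma_algebra_bigcup. Qed.

HB.instance Definition _ := @isMeasurable.Build rV_display
  'rV[R]_n (g_sigma_preimage rV_coord) rV_set0 rV_setC rV_bigcup.

Lemma measurable_rV_coord i : measurable_fun setT (rV_coord i).
Proof.
move=> _ Y mY; rewrite setTI; apply: sub_sigma_algebra => /=.
rewrite -bigcup_seq/=; exists i => /=; first by rewrite mem_index_enum.
by exists Y => //; rewrite setTI.
Qed.

Lemma measurable_fun_rVP d (T : measurableType d) (f : T -> 'rV[R]_n) :
  (forall i, measurable_fun setT (rV_coord i \o f)) -> measurable_fun setT f.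
Proof.
move=> mf _ A; rewrite setTI; move: A.
pose S := [set A : set 'rV[R]_n | measurable (f @^-1` A)].
suff : @measurable _ 'rV[R]_n `<=` S by [].
apply: smallest_sub; first split => /=.
- by rewrite /S /= preimage_set0.
- by move=> A; rewrite /S /= setTD preimage_setC; exact: measurableC.
- move=> F mF; rewrite /S /= preimage_bigcup; apply: bigcup_measurable => k _; exact: mF.
rewrite -bigcup_seq => A [i _ [B mB <-]].
by rewrite /S /= setTI -comp_preimage -[X in measurable X]setTI; exact: mf.
Qed.

End measurable_rV.

Section lebesgue_rV.
Variable R : realType.

Definition cons_rV n (p : measurableTypeR R * 'rV[R]_n) : 'rV[R]_n.+1 :=
  row_mx (p.1)%:M p.2.

Lemma measurable_cons_rV n : measurable_fun setT (@cons_rV n).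
Proof.
apply: measurable_fun_rVP => i.
case: (@split_ordP 1 n i) => [j|j] ->.
  rewrite (_ : _ \o _ = fst); first exact: measurable_fst.
  apply/funext => p /=.
  by rewrite /rV_coord (row_mxEl (p.1)%:M p.2) mxE !ord1 eqxx.
rewrite (_ : _ \o _ = @rV_coord R n j \o snd).
  exact: measurableT_comp (measurable_rV_coord _) measurable_snd.
by apply/funext => p /=; exact: row_mxEr.
Qed.

Section lebesgue_cons.
Variables (n : nat) (mu : {sigma_finite_measure set 'rV[R]_n -> \bar R}).

Definition lebesgue_cons : set 'rV[R]_n.+1 -> \bar R :=
  pushforward (lebesgue_measure \x mu)%E (@cons_rV n).

Let lebesgue_cons0 : lebesgue_cons set0 = 0%E.
Proof. by rewrite /lebesgue_cons /pushforward preimage_set0 measure0. Qed.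

Let lebesgue_cons_ge0 A : (0 <= lebesgue_cons A)%E.
Proof. by rewrite /lebesgue_cons /pushforward; exact: measure_ge0. Qed.

Let lebesgue_cons_sigma_additive : semi_sigma_additive lebesgue_cons.
Proof.
move=> F mF tF mUF; rewrite /lebesgue_cons /pushforward preimage_bigcup.
have mc A : measurable A -> measurable (@cons_rV n @^-1` A).
  by move=> mA; rewrite -[X in measurable X]setTI; exact: measurable_cons_rV.
apply: measure_semi_sigma_additive.
- by move=> k; exact: mc.
- apply/trivIsetP => /= i j _ _ ij; rewrite -preimage_setI.
  by move/trivIsetP : tF => /(_ _ _ _ _ ij) ->//; rewrite preimage_set0.
- by rewrite -preimage_bigcup; exact: mc.
Qed.

HB.instance Definition _ := isMeasure.Build _ _ _ lebesgue_cons
  lebesgue_cons0 lebesgue_cons_ge0 lebesgue_cons_sigma_additive.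

Let lebesgue_cons_sigma_finite : sigma_finite setT lebesgue_cons.
Proof.
have /sigma_finiteP[F [TF ndF Foo]] := sigma_finiteT (@lebesgue_measure R).
have /sigma_finiteP[G [TG ndG Goo]] := sigma_finiteT mu.
pose g (x : 'rV[R]_n.+1) : measurableTypeR R * 'rV[R]_n :=
  (x 0 ord0, \row_j x 0 (lift ord0 j)).
have gK : cancel (@cons_rV n) g.
  have l0 : ord0 = lshift n (ord0 : 'I_1) :> 'I_(1 + n) by exact: val_inj.
  have rS j : lift ord0 j = rshift 1 j :> 'I_(1 + n) by exact: val_inj.
  case=> a x; congr pair.
    by rewrite l0 (row_mxEl a%:M x) mxE eqxx.
  by apply/rowP => j; rewrite mxE rS; exact: (row_mxEr a%:M x).
have mg : measurable_fun setT g.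
  apply: measurable_fun_pair; first exact: (measurable_rV_coord ord0).
  apply: measurable_fun_rVP => j.
  rewrite (_ : _ \o _ = rV_coord (lift ord0 j)).
    exact: measurable_rV_coord.
  by apply/funext => x; rewrite /rV_coord /= mxE.
exists (fun k => g @^-1` (F k `*` G k)).
  apply/seteqP; split=> // x _; have [k _ Fk] : (\bigcup_i F i) (g x).1.
    by rewrite -TF.
  have [l _ Gl] : (\bigcup_i G i) (g x).2 by rewrite -TG.
  exists (maxn k l) => //; split.
    by move: Fk; exact/subsetPset/ndF/leq_maxl.
  by move: Gl; exact/subsetPset/ndG/leq_maxr.
move=> k; have [mF Fk] := Foo k; have [mG Gk] := Goo k; split.
  by rewrite -[X in measurable X]setTI; apply: mg => //; exact: measurableX.
rewrite /lebesgue_cons /pushforward -comp_preimage.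
rewrite (_ : g \o _ = id); last exact/funext.
by rewrite preimage_id product_measure1E// lte_mul_pinfty// ge0_fin_numE.
Qed.

HB.instance Definition _ := Measure_isSigmaFinite.Build _ _ _ lebesgue_cons
  lebesgue_cons_sigma_finite.

End lebesgue_cons.

Fixpoint lebesgue_rV n : {sigma_finite_measure set 'rV[R]_n -> \bar R} :=
  if n is m.+1 then lebesgue_cons (lebesgue_rV m) else \d_(0 : 'rV[R]_0).

End lebesgue_rV.

Section hardy.
Variables (R : realType) (n : nat).
Local Notation Rn := 'rV[R]_n.
Implicit Types (Omega : set Rn) (u phi : Rn -> R) (g : Rn -> Rn).

(* The library norm of 'rV[R]_n is the sup norm. *)
Definition enorm (x : Rn) : R := Num.sqrt (\sum_i x 0 i ^+ 2).

Definition partial (i : 'I_n) (f : Rn -> R) : Rn -> R := 'D_(delta_mx 0 i) f.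

Definition iter_partial (s : seq 'I_n) (f : Rn -> R) : Rn -> R :=
  foldr partial f s.

Definition smooth (f : Rn -> R) : Prop :=
  forall s, continuous (iter_partial s f) /\
    forall i x, derivable (iter_partial s f) x (delta_mx 0 i).

Definition test_function Omega phi : Prop :=
  let supp := closure [set x | phi x != 0] in
  [/\ smooth phi, compact supp & supp `<=` Omega].

Definition L2 Omega u : Prop :=
  measurable_fun Omega u /\
  (\int[@lebesgue_rV R n]_(x in Omega) (u x ^+ 2)%:E < +oo)%E.

(* u is in H^1(Omega) and g is its distributional gradient; only the values on
   Omega matter, and functions are not identified up to null sets. *)
Definition sobolev_H1 Omega u g : Prop :=
  [/\ L2 Omega u, forall i, L2 Omega (fun x => g x 0 i) &
    forall phi, test_function Omega phi -> forall i,
      (\int[@lebesgue_rV R n]_(x in Omega) (u x * partial i phi x)%:E =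
       - \int[@lebesgue_rV R n]_(x in Omega) (g x 0 i * phi x)%:E)%E].

(* u is in H^1_0(Omega), the closure of the test functions in H^1(Omega), and
   g is its distributional gradient. *)
Definition sobolev_H10 Omega u g : Prop :=
  sobolev_H1 Omega u g /\
  exists phi : nat -> Rn -> R, (forall k, test_function Omega (phi k)) /\
    (\int[@lebesgue_rV R n]_(x in Omega)
      ((phi k x - u x) ^+ 2 + \sum_i (partial i (phi k) x - g x 0 i) ^+ 2)%:E)%E
      @[k --> \oo] --> 0%E.

(* In \bar R the inverse of +oo is 0, so that a quotient with infinite
   denominator is 0. *)
Definition hardy_quotient Omega u g : \bar R :=
  ((\int[@lebesgue_rV R n]_(x in Omega) (enorm (g x) ^+ 2)%:E) /
   (\int[@lebesgue_rV R n]_(x in Omega) (u x ^+ 2 / enorm x ^+ 2)%:E))%E.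

Definition hardy_constant Omega : \bar R :=
  ereal_inf [set q | exists u g, [/\ sobolev_H10 Omega u g,
    ~ {ae @lebesgue_rV R n, forall x, Omega x -> u x = 0} &
    q = hardy_quotient Omega u g]].

End hardy.

(* The ambient space is R^N with N = n.+1, so that the last coordinate x_N is
   x 0 ord_max. *)
Definition cone (R : realType) (n : nat) (gamma : R) : set 'rV[R]_n.+1 :=
  [set x | x != 0 /\ x 0 ord_max > enorm x * cos gamma].

(* Main.v *)
Require Import Defs.
From mathcomp Require Import all_boot all_order all_algebra.
From mathcomp Require Import all_classical all_reals all_analysis.
From mathcomp Require Import measurable_realfun ring lra.
Set Implicit Arguments.
Unset Strict Implicit.
Unset Printing Implicit Defensive.
Import Order.TTheory GRing.Theory Num.Theory.
Import numFieldNormedType.Exports.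
Local Open Scope classical_set_scope.
Local Open Scope ring_scope.

(** Write N for the dimension, L for the logarithm of |x|^2, t = x_N / |x| for
the cosine of the angle with the axis, and alpha = (N - 2) / 2. A cone of slot
gamma is the set t > cos gamma, so it suffices to squeeze the Hardy constant
between N^2/4 - e and N^2/4 + e as soon as |cos gamma| is small
([hardy_constant_cone]); both the limit and the value at pi/2 follow. The
number N^2/4 is alpha^2 + (N - 1), where N - 1 is the first Dirichlet eigenvalue
of the hemisphere, with eigenfunction t.

Both bounds rest on one tool, the divergence theorem for compactly supported
C^1 fields ([integral_partial_eq0], proved by Fubini and the fundamental theorem
of calculus), and on the Laplacian of products P(L) f(t) ([laplacian_polar]).

Lower bound. If w > 0 satisfies - Delta w >= kappa w / |x|^2 on Omega, then
integrating div (phi^2 grad w / w) <= |grad phi|^2 - kappa phi^2 / |x|^2 gives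
the Hardy inequality with constant kappa for test functions
([supersolution_hardy]). It passes to H^1_0 by truncating the weight
([hardy_cutoff]) and monotone convergence ([hardy_H10]). In t > -c one takes
w = |x|^(-alpha) (t + 2c - 2c(N-1) t^2), for which kappa = N^2/4 - e when c is
small ([angular_supersolution]).

Upper bound. If a test function phi satisfies
- phi Delta phi <= kappa phi^2 / |x|^2, then integrating div (phi grad phi)
bounds its quotient by kappa ([subsolution_energy]). Such a phi is built from
the flat function exp(-1/y): the radial factor is
|x|^(-alpha) exp(-1 / (1 - b L^2)) and the angular factor is
(t - d) exp(-d / (t - d)) ([radial_subsolution], [angular_subsolution]). Its
support lies in t >= d, hence in every cone with cos gamma < d. *)

(** * Directional derivatives and functions of class C^k *)

Section directional_derivatives.
Variable R : realType.

(** Reduces directional derivatives to one real variable, where the chain rule is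
available. *)
Lemma is_derive_line (V : normedModType R) (f : V -> R) (x v : V) (df : R) :
  is_derive x v f df <-> is_derive (0 : R) 1 (fun h => f (h *: v + x)) df.
Proof.
have E : 'D_v f x = 'D_1 (fun h : R => f (h *: v + x)) 0.
  rewrite /derive; do 2 f_equal; apply/funext => h /=.
  by rewrite addr0 scale0r add0r [in RHS]/GRing.scale /= mulr1.
split=> -[df1 df2]; split.
- exact: (derivable1P f x v).1.
- by rewrite -E.
- exact: (derivable1P f x v).2.
- by rewrite E.
Qed.

Lemma is_derive_comp (V : normedModType R) (a : R -> R) (g : V -> R)
    (x v : V) (da dg : R) :
  is_derive (g x) 1 a da -> is_derive x v g dg ->
  is_derive x v (fun y => a (g y)) (da * dg).
Proof.
move=> ha /is_derive_line hg; apply/is_derive_line.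
have := @is_derive1_comp R a (fun h => g (h *: v + x)) 0 da dg.
by apply => //; rewrite scale0r add0r.
Qed.

Lemma is_derive_mul (V : normedModType R) (f g : V -> R) (x v : V) (df dg : R) :
  is_derive x v f df -> is_derive x v g dg ->
  is_derive x v (fun y => f y * g y) (df * g x + f x * dg).
Proof.
move=> hf hg; apply: (is_derive_eq (is_deriveM hf hg)).
by rewrite /GRing.scale /=; ring.
Qed.

Lemma is_derive_add (V : normedModType R) (f g : V -> R) (x v : V) (df dg : R) :
  is_derive x v f df -> is_derive x v g dg ->
  is_derive x v (fun y => f y + g y) (df + dg).
Proof. by move=> hf hg; exact: (is_deriveD hf hg). Qed.

Lemma is_derive_const (V : normedModType R) (c : R) (x v : V) :
  is_derive x v (fun=> c) 0.
Proof. exact: is_derive_cst. Qed.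

Lemma is_derive_scale (V : normedModType R) (f : V -> R) (c : R) (x v : V)
    (df : R) :
  is_derive x v f df -> is_derive x v (fun y => c * f y) (c * df).
Proof.
move=> hf; apply: (is_derive_eq (is_derive_mul (is_derive_const c x v) hf)).
by rewrite mul0r add0r.
Qed.

Lemma is_derive_coord n (i j : 'I_n) (x : 'rV[R]_n) :
  is_derive x (delta_mx 0 i) (fun y => y 0 j) (j == i)%:R.
Proof.
apply/is_derive_line.
rewrite (_ : (fun _ => _) = fun h => h * (j == i)%:R + x 0 j); last first.
  by apply/funext => h; rewrite !mxE eqxx.
apply: (is_derive_eq (is_derive_add (is_derive_mul (is_derive_id _ _)
  (is_derive_const _ _ _)) (is_derive_const _ _ _))).
by rewrite mulr0 mul1r !addr0.
Qed.

End directional_derivatives.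

Section Ck.
Variables (R : realType) (n : nat).
Local Notation Rn := 'rV[R]_n.
Implicit Types (U V : set Rn) (f g : Rn -> R).

(** Continuity is recorded at every order because derivability along the basis
vectors does not imply it. Over the whole space, having this for every k is
exactly smoothness ([Ck_smooth], [smooth_Ck]). *)
Fixpoint Ck k U f : Prop :=
  (forall x, U x -> {for x, continuous f}) /\
  if k is k'.+1 then
    forall i, (forall x, U x -> derivable f x (delta_mx 0 i)) /\
              Ck k' U (partial i f)
  else True.

Lemma Ck_continuous k U f x : Ck k U f -> U x -> {for x, continuous f}.
Proof. by case: k => [|k] [cf _]; exact: cf. Qed.

Lemma Ck_is_derive k U f x i : Ck k.+1 U f -> U x ->
  is_derive x (delta_mx 0 i) f (partial i f x).
Proof. by move=> [_ /(_ i)[df _]] Ux; apply: derivableP; exact: df. Qed.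

Lemma Ck_partial k U f i : Ck k.+1 U f -> Ck k U (partial i f).
Proof. by move=> [_ /(_ i)[]]. Qed.

Lemma CkS k U f : Ck k.+1 U f -> Ck k U f.
Proof.
elim: k f => [|k IH] f [cf df]; first by [].
by split=> // i; have [d1 d2] := df i; split=> //; exact: IH.
Qed.

Lemma Ck_sub k U V f : U `<=` V -> Ck k V f -> Ck k U f.
Proof.
move=> UV; elim: k f => [|k IH] f [cf df]; split; first by move=> x /UV/cf.
- by [].
- by move=> x /UV/cf.
- by move=> i; have [d1 d2] := df i; split; [move=> x /UV/d1|exact: IH].
Qed.

Lemma Ck_union k U V f : Ck k U f -> Ck k V f -> Ck k (U `|` V) f.
Proof.
elim: k f => [|k IH] f [cf df] [cf' df']; split=> //; try by move=> x [/cf|/cf'].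
move=> i; have [d1 d2] := df i; have [d1' d2'] := df' i.
by split; [move=> x [/d1|/d1']|exact: IH].
Qed.

(** Openness of U makes the class depend on the values on U only. *)
Lemma eq_Ck k U f g : open U -> (forall x, U x -> f x = g x) ->
  Ck k U f -> Ck k U g.
Proof.
move=> oU; elim: k f g => [|k IH] f g fg [cf df].
all: have nfg x : U x -> \forall y \near x, f y = g y
  by move=> Ux; apply: filterS (open_nbhs_nbhs (conj oU Ux)) => y /fg.
all: have cg x : U x -> {for x, continuous g}
  by move=> Ux; rewrite /prop_for /continuous_at -(fg _ Ux);
     apply: cvg_trans (cf _ Ux); apply: (@near_eq_cvg _ _ (nbhs x)); exact: nfg.
  by split.
split=> // i; have [d1 d2] := df i; split.
  move=> x Ux; apply: near_eq_derivable (d1 _ Ux); exact: nfg.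
apply: IH d2 => x Ux; apply: near_eq_derive; exact: nfg.
Qed.

Lemma Ck_derivative k U f : open U -> (forall x, U x -> {for x, continuous f}) ->
  (forall i, exists f', (forall x, U x -> is_derive x (delta_mx 0 i) f (f' x)) /\
    Ck k U f') -> Ck k.+1 U f.
Proof.
move=> oU cf df; split=> // i; have [f' [d1 d2]] := df i; split.
  by move=> x Ux; have [] := d1 _ Ux.
by apply: eq_Ck d2 => // x Ux; have [_ <-] := d1 _ Ux.
Qed.

Lemma Ck_cst k U c : Ck k U (fun=> c).
Proof.
elim: k c => [|k IH] c; split=> //; try by move=> x _; exact: cst_continuous.
move=> i; split; first by move=> x _; exact: derivable_cst.
rewrite (_ : partial _ _ = fun=> 0); first exact: IH.
by apply/funext => x; exact: derive_cst.
Qed.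

Lemma CkD k U f g : open U -> Ck k U f -> Ck k U g ->
  Ck k U (fun x => f x + g x).
Proof.
move=> oU; elim: k f g => [|k IH] f g Cf Cg.
  by split=> // x Ux; exact: (continuousD (Ck_continuous Cf Ux) (Ck_continuous Cg Ux)).
apply: Ck_derivative => //.
  by move=> x Ux; exact: (continuousD (Ck_continuous Cf Ux) (Ck_continuous Cg Ux)).
move=> i; exists (fun x => partial i f x + partial i g x); split.
  by move=> x Ux; exact: (is_derive_add (Ck_is_derive i Cf Ux) (Ck_is_derive i Cg Ux)).
by apply: IH; exact: Ck_partial.
Qed.

Lemma CkM k U f g : open U -> Ck k U f -> Ck k U g ->
  Ck k U (fun x => f x * g x).
Proof.
move=> oU; elim: k f g => [|k IH] f g Cf Cg.
  by split=> // x Ux; exact: (continuousM (Ck_continuous Cf Ux) (Ck_continuous Cg Ux)).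
apply: Ck_derivative => //.
  by move=> x Ux; exact: (continuousM (Ck_continuous Cf Ux) (Ck_continuous Cg Ux)).
move=> i; exists (fun x => partial i f x * g x + f x * partial i g x); split.
  by move=> x Ux; exact: (is_derive_mul (Ck_is_derive i Cf Ux) (Ck_is_derive i Cg Ux)).
by apply: CkD => //; apply: IH; do ?[exact: CkS|exact: Ck_partial].
Qed.

Lemma CkZ k U c f : open U -> Ck k U f -> Ck k U (fun x => c * f x).
Proof. by move=> oU Cf; apply: CkM => //; exact: Ck_cst. Qed.

Lemma Ck_sum k U (I : Type) (r : seq I) (f : I -> Rn -> R) : open U ->
  (forall i, Ck k U (f i)) -> Ck k U (fun x => \sum_(i <- r) f i x).
Proof.
move=> oU Cf; elim: r => [|i r IH].
  by under eq_fun do rewrite big_nil; exact: Ck_cst.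
by under eq_fun do rewrite big_cons; exact: CkD.
Qed.

Lemma Ck_coord k U j : open U -> Ck k U (fun x => x 0 j).
Proof.
have cc x : U x -> {for x, continuous (fun x : Rn => x 0 j)}.
  by move=> _; exact: coord_continuous.
move=> oU; case: k => [|k]; first by split.
apply: Ck_derivative => // i; exists (fun=> (j == i)%:R); split.
  by move=> x _; exact: is_derive_coord.
exact: Ck_cst.
Qed.

(** The outer function is taken in a set S closed under differentiation on V', so
that the induction on k never has to name its k-th derivative. *)
Lemma Ck_comp k U (V' : set R) (S : set (R -> R)) a g : open U ->
  (forall b, S b -> forall y, V' y -> {for y, continuous b}) ->
  (forall b, S b -> exists2 b', S b' & forall y, V' y -> is_derive y 1 b (b' y)) ->
  S a -> (forall x, U x -> V' (g x)) -> Ck k U g -> Ck k U (fun x => a (g x)).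
Proof.
move=> oU cS dS Sa gV; elim: k a Sa => [|k IH] a Sa Cg.
  split=> // x Ux; apply: continuous_comp; first exact: (Ck_continuous Cg Ux).
  by apply: cS => //; exact: gV.
apply: Ck_derivative => //.
  move=> x Ux; apply: continuous_comp; first exact: (Ck_continuous Cg Ux).
  by apply: cS => //; exact: gV.
move=> i; have [a' Sa' da] := dS _ Sa.
exists (fun x => a' (g x) * partial i g x); split.
  move=> x Ux; apply: is_derive_comp; first by apply: da; exact: gV.
  exact: (Ck_is_derive i Cg Ux).
apply: CkM => //; last exact: Ck_partial.
by apply: IH => //; exact: CkS.
Qed.

Lemma Ck_expR k U g : open U -> Ck k U g -> Ck k U (fun x => expR (g x)).
Proof.
move=> oU; apply: (@Ck_comp k U setT [set expR]) => //.
- by move=> _ -> y _; exact: continuous_expR.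
- by move=> _ ->; exists expR => // y _; exact: is_derive_expR.
Qed.

(** Since ln' = exp (- ln), the induction only needs the exponential. *)
Lemma Ck_ln k U g : open U -> (forall x, U x -> 0 < g x) -> Ck k U g ->
  Ck k U (fun x => ln (g x)).
Proof.
move=> oU g0; elim: k => [|k IH] Cg.
  by split=> // x Ux; apply: continuous_comp; [exact: (Ck_continuous Cg Ux)|
    apply: continuous_ln; exact: g0].
apply: Ck_derivative => //.
  move=> x Ux; apply: continuous_comp; first exact: (Ck_continuous Cg Ux).
  by apply: continuous_ln; exact: g0.
move=> i; exists (fun x => expR (- 1 * ln (g x)) * partial i g x); split.
  move=> x Ux; apply: is_derive_comp; last exact: (Ck_is_derive i Cg Ux).
  have gx0 := g0 _ Ux; rewrite mulN1r expRN lnK ?posrE//.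
  exact: is_derive1_ln.
apply: CkM => //; last exact: Ck_partial.
by apply: Ck_expR => //; apply: CkZ => //; apply: IH; exact: CkS.
Qed.

Lemma Ck_smooth f : (forall k, Ck k setT f) -> smooth f.
Proof.
move=> Cf s; have {}Cf k : Ck k setT (iter_partial s f).
  elim: s k => [|i s IH] k; first exact: Cf.
  by apply: Ck_partial; exact: IH.
by split=> [x|i x]; [exact: (Cf 0).1|exact: ((Cf 1).2 i).1].
Qed.

Lemma smooth_Ck f k : smooth f -> Ck k setT f.
Proof.
move=> sf; suff H s : Ck k setT (iter_partial s f) by exact: (H [::]).
elim: k s => [|k IH] s; have [c d] := sf s; first by split=> // x _; exact: c.
split=> [x _|i]; first exact: c.
by split=> [x _|]; [exact: d|exact: (IH (i :: s))].
Qed.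

End Ck.

(** * Borel sets and Lebesgue measure on row vectors *)

Section borel.
Variables (R : realType) (n : nat).
Local Notation Rn := 'rV[R]_n.

Lemma rV_ballE (x y : Rn) (e : R) :
  0 < e -> ball x e y <-> forall j, `|x 0 j - y 0 j| < e.
Proof.
move=> e0; split=> [[_ h] j|h]; first exact: h.
by split=> // i j; rewrite ord1; exact: h.
Qed.

Lemma measurable_rV_ball (x : Rn) (e : R) : measurable (ball x e).
Proof.
have [e0|e0] := ltP 0 e; last first.
  rewrite (_ : ball x e = set0); first exact: measurable0.
  by apply/seteqP; split=> // y [/lt_geF]; rewrite e0.
rewrite (_ : ball x e = \bigcap_(j in [set: 'I_n])
    (@rV_coord R n j @^-1` (ball (x 0 j) e))); last first.
  apply/seteqP; split=> [y /(rV_ballE _ _ e0) h j _|y h]; first exact: h.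
  by apply/(rV_ballE _ _ e0) => j; exact: h.
apply: fin_bigcap_measurable; first exact: finite_finset.
move=> j _; rewrite -[X in measurable X]setTI.
apply: measurable_rV_coord => //; exact: measurable_ball.
Qed.

(** An open set is the countable union of the sup-norm balls with rational centre
and radius 1/(m+1) that it contains, and these balls are boxes. *)
Lemma open_measurable_rV (U : set Rn) : open U -> measurable U.
Proof.
move=> oU.
pose c (p : 'rV[rat]_n * nat) : Rn := \row_j ratr (p.1 0 j).
pose r (p : 'rV[rat]_n * nat) : R := (p.2.+1%:R)^-1.
pose F p := [set x | ball (c p) (r p) `<=` U /\ ball (c p) (r p) x].
rewrite (_ : U = \bigcup_p F p); last first.
  apply/seteqP; split=> [x Ux|x [p _]]; last first.
    by case=> pU /pU.
  have /nbhs_ballP[e /= e0 eU] : nbhs x U by apply: open_nbhs_nbhs.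
  have [m [d [dE d0 de]]] : exists m (d : R), [/\ m.+1%:R^-1 = d, 0 < d & 2 * d < e].
    have e20 : 0 < e / 2 by lra.
    have [m _ mP] := near_infty_natSinv_lt (PosNum e20).
    exists m, m.+1%:R^-1; split=> //.
    by rewrite mulrC -ltr_pdivlMr//; exact: (mP m (leqnn m)).
  have /choice[q qP] : forall j, exists q : rat, `|ratr q - x 0 j| < d.
    move=> j; have h : x 0 j - d < x 0 j + d by lra.
    have [q] := rat_in_itvoo h; rewrite in_itv /= => /andP[q1 q2].
    by exists q; rewrite ltr_norml; apply/andP; split; lra.
  pose p := (\row_j q j, m) : 'rV[rat]_n * nat.
  have rE : r p = d by exact: dE.
  exists p => //; rewrite /F/= rE; split; last first.
    by apply/rV_ballE => // j; rewrite !mxE.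
  move=> y /(rV_ballE _ _ d0) yc; apply/eU/rV_ballE => // j.
  have := yc j; have := qP j; rewrite !mxE !ltr_norml.
  move=> /andP[q1 q2] /andP[q3 q4]; apply/andP; split; lra.
apply: countable_bigcupT_measurable.
  exact: countableP.
move=> p; have [pU|pU] := pselect (ball (c p) (r p) `<=` U).
  rewrite (_ : F p = ball (c p) (r p)); first exact: measurable_rV_ball.
  by apply/seteqP; split=> [x []//|x xp]; split.
rewrite (_ : F p = set0); first exact: measurable0.
by apply/seteqP; split=> // x [].
Qed.

Lemma continuous_measurable_rV (f : Rn -> R) :
  continuous f -> measurable_fun setT f.
Proof.
move=> /continuousP cf; apply: (measurability _ (RGenOpens.measurableE R)).
move=> _ [_ [a [b ->] <-]]; rewrite setTI; apply: open_measurable_rV.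
exact/cf/interval_open.
Qed.

Lemma continuous_rV (T : topologicalType) (f : T -> Rn) :
  (forall j, continuous (fun t => f t 0 j)) -> continuous f.
Proof.
move=> cf t; apply/cvg_ballP => e e0.
have : \forall s \near t, forall j, ball (f t 0 j) e (f s 0 j).
  apply: filter_forall => j.
  by move/cvg_ballP: (cf j t) => /(_ _ e0).
by apply: filterS => s h; apply/rV_ballE.
Qed.

End borel.

Section bounded_support.
Variables (R : realType) (n : nat).
Local Notation Rn := 'rV[R]_n.

Definition bounded_support (f : Rn -> R) :=
  exists2 M : R, 0 < M & forall x, M <= `|x| -> f x = 0.

Lemma continuous_bounded (f : Rn -> R) : continuous f -> bounded_support f ->
  exists C : R, forall x, `|f x| <= C.
Proof.
move=> cf [M M0 fM].
pose A : set Rn := [set x | `|x| <= M].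
have cA : compact A.
  apply: bounded_closed_compact.
    by exists M; split; [exact: gtr0_real|move=> y My x Ax; exact/ltW/(le_lt_trans Ax)].
  rewrite (_ : A = (fun x : Rn => `|x|) @^-1` [set` Interval -oo%O (BRight M)]).
    by apply: closed_comp; [move=> x _; exact: norm_continuous|exact: interval_closed].
  by apply/seteqP; split=> x; rewrite /= in_itv.
have A0 : A !=set0 by exists 0; rewrite /A/= normr0 ltW.
have cnf : {within A, continuous (fun x => `|f x|)}.
  apply: continuous_subspaceT => x; apply: continuous_comp; first exact: cf.
  exact: norm_continuous.
have [c _ cP] := EVT_max_rV A0 cA cnf.
exists `|f c| => x; have [xM|xM] := leP `|x| M.
  by apply: cP; rewrite inE.
by rewrite fM ?normr0// ltW.
Qed.

End bounded_support.

Section lebesgue.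
Variable R : realType.

Lemma cons_rV0 n p : @cons_rV R n p 0 ord0 = p.1.
Proof.
have -> : ord0 = lshift n (ord0 : 'I_1) :> 'I_(1 + n) by exact: val_inj.
by rewrite (row_mxEl (p.1)%:M p.2) mxE eqxx.
Qed.

Lemma cons_rVS n p j : @cons_rV R n p 0 (lift ord0 j) = p.2 0 j.
Proof.
have -> : lift ord0 j = rshift 1 j :> 'I_(1 + n) by exact: val_inj.
exact: (row_mxEr (p.1)%:M p.2).
Qed.

(** Splits off the first coordinate, which is the one that the measure on R^(n+1)
adds to the measure on R^n. *)
Lemma ord0_or_lift n (P : 'I_n.+1 -> Prop) :
  P ord0 -> (forall j, P (lift ord0 j)) -> forall i, P i.
Proof. by move=> P0 PS i; case: (unliftP ord0 i) => [j|] ->. Qed.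

Lemma lebesgue_rV_ball n (x : 'rV[R]_n) (e : R) : 0 < e ->
  lebesgue_rV R n (ball x e) = ((e *+ 2) ^+ n)%:E.
Proof.
elim: n x => [|n IH] x e0.
  rewrite /= diracE expr0 mem_set//.
  by apply/rV_ballE => // -[].
rewrite /=/lebesgue_cons/pushforward.
rewrite (_ : _ @^-1` _ = ball (x 0 ord0) e `*` ball (\row_j x 0 (lift ord0 j)) e).
  have mb : measurable (ball (x 0 ord0 : R) e : set (measurableTypeR R)).
    exact: measurable_ball.
  have mb' := measurable_rV_ball (\row_j x 0 (lift ord0 j)) e.
  rewrite product_measure1E//= IH//.
  have -> := lebesgue_measure_ball (x 0 ord0) (ltW e0).
  by rewrite -EFinM exprS.
apply/seteqP; split=> [p /= /(rV_ballE _ _ e0) h|p /= [h0 /(rV_ballE _ _ e0) h]].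
  split; first by have := h ord0; rewrite cons_rV0.
  by apply/rV_ballE => // j; have := h (lift ord0 j); rewrite cons_rVS mxE.
apply/rV_ballE => //; elim/ord0_or_lift => [|j]; first by rewrite cons_rV0.
by rewrite cons_rVS; have := h j; rewrite mxE.
Qed.

Lemma lebesgue_rV_open_gt0 n (U : set 'rV[R]_n) : open U -> U !=set0 ->
  (0 < lebesgue_rV R n U)%E.
Proof.
move=> oU [x Ux]; have /nbhs_ballP[e /= e0 eU] := open_nbhs_nbhs (conj oU Ux).
apply: (@lt_le_trans _ _ (lebesgue_rV R n (ball x e))).
  by rewrite lebesgue_rV_ball// lte_fin exprn_gt0// mulrn_wgt0.
by apply: le_measure => //; rewrite inE;
  [exact: measurable_rV_ball|exact: open_measurable_rV].
Qed.

Lemma bounded_finite_integrable d (T : measurableType d)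
    (mu : {measure set T -> \bar R}) (A : set T) (f : T -> R) (C : R) :
  measurable A -> (mu A < +oo)%E -> measurable_fun setT f ->
  (forall x, `|f x| <= C) -> (forall x, ~ A x -> f x = 0) ->
  mu.-integrable setT (EFin \o f).
Proof.
move=> mA Afin mf fC fA.
have fE : EFin \o f = (EFin \o f) \_ A.
  apply/funext => x; rewrite patchE; case: ifPn => // /negP; rewrite inE => nA.
  by rewrite /= fA.
rewrite fE -integrable_mkcond//.
apply: measurable_bounded_integrable => //; first exact: measurable_funTS.
exists C; split; first exact: num_real.
by move=> y Cy x _; exact/ltW/(le_lt_trans (fC x)).
Qed.

Lemma bounded_support_integrable n (f : 'rV[R]_n -> R) :
  continuous f -> bounded_support f ->
  (lebesgue_rV R n).-integrable setT (EFin \o f).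
Proof.
move=> cf sf; have [C fC] := continuous_bounded cf sf; case: sf => M M0 fM.
apply: (@bounded_finite_integrable _ _ (lebesgue_rV R n) (ball 0 M) f C) => //.
- exact: measurable_rV_ball.
- by rewrite [X in (X < _)%E](@lebesgue_rV_ball n 0 M M0) ltry.
- exact: continuous_measurable_rV.
- move=> x xM; apply: fM; rewrite leNgt; apply/negP => xM'; apply: xM.
  by rewrite mx_norm_ball /ball_/= sub0r normrN.
Qed.

Lemma integral_lebesgue_cons n (f : 'rV[R]_n.+1 -> R) :
  continuous f -> bounded_support f ->
  (lebesgue_measure \x lebesgue_rV R n)%E.-integrable setT
     (fun p => (f (cons_rV p))%:E) /\
  (\int[lebesgue_rV R n.+1]_x (f x)%:E =
   \int[(lebesgue_measure \x lebesgue_rV R n)%E]_p (f (cons_rV p))%:E)%E.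
Proof.
move=> cf sf; have [C fC] := continuous_bounded cf sf; case: sf => M M0 fM.
have mf := continuous_measurable_rV cf.
have mA : measurable (@cons_rV R n @^-1` ball 0 M).
  rewrite -[X in measurable X]setTI; apply: measurable_cons_rV => //.
  exact: measurable_rV_ball.
have fi : (lebesgue_measure \x lebesgue_rV R n)%E.-integrable setT
     (EFin \o (f \o @cons_rV R n)).
  apply: (@bounded_finite_integrable _ _ (lebesgue_measure \x lebesgue_rV R n)%E
    (@cons_rV R n @^-1` ball 0 M) (f \o @cons_rV R n) C) => //.
  - by rewrite [X in (X < _)%E](@lebesgue_rV_ball n.+1 0 M M0) ltry.
  - by apply: measurableT_comp => //; exact: measurable_cons_rV.
  - by move=> x; exact: fC.
  - move=> x xM; apply: fM; rewrite leNgt; apply/negP => xM'; apply: xM.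
    by rewrite /preimage/= mx_norm_ball /ball_/= sub0r normrN.
split=> //; rewrite (@integral_pushforward _ _ _ _ _ _ (@measurable_cons_rV R n)
  (lebesgue_measure \x lebesgue_rV R n)%E setT (EFin \o f)) //.
exact/measurable_EFinP.
Qed.

End lebesgue.

(** * The divergence theorem *)

Section divergence.
Variable R : realType.

(** F vanishes at both ends of [-M, M], and f vanishes outside. *)
Lemma integral_derivative_eq0 (F f : R -> R) (M : R) : 0 < M ->
  (forall x : R, is_derive x 1 F (f x)) -> continuous f ->
  (forall x, M <= `|x| -> F x = 0) -> (forall x, M <= `|x| -> f x = 0) ->
  (\int[lebesgue_measure]_x (f x)%:E = 0)%E.
Proof.
move=> M0 dF cf FM fM.
have MM : - M < M by lra.
have -> : (fun x => (f x)%:E) = (fun x => (f x)%:E) \_ `[- M, M].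
  apply/funext => x; rewrite patchE; case: ifPn => //.
  rewrite notin_setE /= in_itv/= => /negP; rewrite -ler_norml -ltNge => /ltW.
  by move=> /fM ->.
rewrite -integral_mkcond.
have cF : continuous F.
  move=> x; apply: differentiable_continuous; apply/derivable1_diffP.
  by have [] := dF x.
rewrite (@continuous_FTC2 _ f F)//.
- have [FM1 FM2] : F M = 0 /\ F (- M) = 0.
    by split; apply: FM; rewrite ?normrN gtr0_norm.
  by rewrite FM1 FM2 oppe0 adde0.
- exact: continuous_subspaceT.
- split.
  + by move=> x _; have [] := dF x.
  + exact/cvg_at_right_filter/cF.
  + exact/cvg_at_left_filter/cF.
- by move=> x _; rewrite derive1E; have [_ ->] := dF x.
Qed.

Lemma bounded_support_partial n (G : 'rV[R]_n -> R) i :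
  bounded_support G -> bounded_support (partial i G).
Proof.
move=> [M M0 GM]; exists (M + 1); first lra.
move=> x xM; rewrite /partial (@near_eq_derive _ _ _ G (cst 0)) ?derive_cst//.
have xM' : M < `|x| by lra.
have : \forall y \near x, M < `|y|.
  by have /cvgr_gt := @norm_continuous R _ x; apply.
by apply: filterS => y yM; rewrite GM// ltW.
Qed.

Lemma cons_rV_norm n (a : R) (x : 'rV[R]_n) (M : R) : 0 <= M ->
  (`|cons_rV (a, x)| < M) = (`|a| < M) && (`|x| < M).
Proof.
move=> M0.
have nE k (y : 'rV[R]_k) : 0 < M -> (`|y| < M) <-> (forall j, `|y 0 j| < M).
  move=> {}M0; have := rV_ballE 0 y M0; rewrite mx_norm_ball /ball_/= sub0r normrN.
  by move=> ->; split=> h j; have := h j; rewrite mxE sub0r normrN.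
move: M0; rewrite le_eqVlt => /predU1P[<-|M0].
  by rewrite !ltNge !normr_ge0.
apply/idP/andP => [/(nE _ _ M0) h|[aM /(nE _ _ M0) xM]].
  split; first by have := h ord0; rewrite cons_rV0.
  by apply/(nE _ _ M0) => j; have := h (lift ord0 j); rewrite cons_rVS.
by apply/(nE _ _ M0); elim/ord0_or_lift => [|j]; rewrite ?cons_rV0 ?cons_rVS.
Qed.

Lemma continuous_cons_rV_l n (a : R) : continuous (fun x : 'rV[R]_n => cons_rV (a, x)).
Proof.
apply: continuous_rV; elim/ord0_or_lift => [|j].
  by under eq_fun do rewrite cons_rV0/=; exact: cst_continuous.
by under eq_fun do rewrite cons_rVS/=; move=> x; exact: coord_continuous.
Qed.

Lemma continuous_cons_rV_r n (x : 'rV[R]_n) : continuous (fun a : R => cons_rV (a, x)).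
Proof.
apply: continuous_rV; elim/ord0_or_lift => [|j].
  by under eq_fun do rewrite cons_rV0/=; move=> y; exact: cvg_id.
by under eq_fun do rewrite cons_rVS/=; exact: cst_continuous.
Qed.

Lemma cons_rVD0 n (a h : R) (x : 'rV[R]_n) :
  h *: delta_mx 0 ord0 + cons_rV (a, x) = cons_rV (h + a, x).
Proof.
apply/rowP; elim/ord0_or_lift => [|j].
all: rewrite [LHS]mxE [X in X + _]mxE [delta_mx _ _ _ _]mxE ?cons_rV0 ?cons_rVS.
  by rewrite !eqxx mulr1.
by rewrite eqxx /= mulr0 add0r.
Qed.

Lemma cons_rVDS n (a h : R) (x : 'rV[R]_n) j :
  h *: delta_mx 0 (lift ord0 j) + cons_rV (a, x) = cons_rV (a, h *: delta_mx 0 j + x).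
Proof.
apply/rowP; elim/ord0_or_lift => [|k].
all: rewrite [LHS]mxE [X in X + _]mxE [delta_mx _ _ _ _]mxE ?cons_rV0 ?cons_rVS.
  by rewrite eqxx /= mulr0 add0r.
by rewrite !mxE (inj_eq lift_inj).
Qed.

(** Induction on the dimension. By Fubini the first variable can be integrated
first, which gives 0 along each line when i is the first coordinate; otherwise
the other variables are integrated first, and the slices of G satisfy the
induction hypothesis. *)
Theorem integral_partial_eq0 n (i : 'I_n) (G : 'rV[R]_n -> R) :
  bounded_support G -> (forall x, derivable G x (delta_mx 0 i)) ->
  continuous (partial i G) ->
  (\int[lebesgue_rV R n]_x (partial i G x)%:E = 0)%E.
Proof.
elim: n i G => [[]//|n IH] i G sG dG cG.
have spG := bounded_support_partial i sG.
have [fi ->] := integral_lebesgue_cons cG spG.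
move: i dG cG spG fi; elim/ord0_or_lift => [|j] dG cG spG fi.
  rewrite -integral21_prod_meas1//; apply: integral0_eq => y _.
  have [M M0 GM] := sG; have [M' M'0 GM'] := spG.
  (* On the line through y, both G and its derivative vanish beyond K. *)
  pose K := Num.max M M'.
  have far a k : k <= K -> K <= `|a| -> k <= `|cons_rV (a, y)|.
    move=> kK aK; apply: le_trans kK _; rewrite leNgt; apply/negP.
    rewrite cons_rV_norm ?(le_max, ltW M0)// => /andP[].
    by rewrite ltNge aK.
  apply: (@integral_derivative_eq0 (fun a => G (cons_rV (a, y))) _ K).
  - by rewrite lt_max M0.
  - move=> a; apply/is_derive_line.
    have /is_derive_line := derivableP (dG (cons_rV (a, y))).
    rewrite /partial; congr (is_derive _ _ _ _); apply/funext => h.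
    by rewrite cons_rVD0 [in RHS]/GRing.scale /= mulr1.
  - move=> a; apply: continuous_comp; first exact: continuous_cons_rV_r.
    exact: cG.
  - by move=> a aK; apply: GM; apply: far => //; rewrite le_max lexx.
  - by move=> a aK; apply: GM'; apply: far => //; rewrite le_max lexx orbT.
rewrite -integral12_prod_meas1//; apply: integral0_eq => a _.
have pE : (fun x => partial (lift ord0 j) G (cons_rV (a, x))) =
    partial j (fun x => G (cons_rV (a, x))).
  apply/funext => x; symmetry; apply: (derive_val (is_derive := _)).
  apply/is_derive_line.
  have /is_derive_line := derivableP (dG (cons_rV (a, x))).
  rewrite /partial; congr (is_derive _ _ _ _); apply/funext => h.
  by rewrite cons_rVDS.
rewrite /fubini_F/= (_ : (fun y => _) =
    (fun x => (partial j (fun x => G (cons_rV (a, x))) x)%:E)); last first.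
  by apply/funext => x; rewrite -pE.
apply: IH.
- have [M M0 GM] := sG; exists M => // x xM; apply: GM; rewrite leNgt.
  by apply/negP; rewrite cons_rV_norm ?ltW// => /andP[_]; rewrite ltNge xM.
- move=> x; have /is_derive_line := derivableP (dG (cons_rV (a, x))).
  under eq_fun do rewrite cons_rVDS.
  by move=> /(is_derive_line (fun x => G (cons_rV (a, x))) x)[].
- rewrite -pE => x; apply: continuous_comp; first exact: continuous_cons_rV_l.
  exact: cG.
Qed.

End divergence.

(** * Test functions and positive supersolutions *)

Section test_functions.
Variables (R : realType) (n : nat).
Local Notation Rn := 'rV[R]_n.
Local Notation mu := (lebesgue_rV R n).
Implicit Types (Omega : set Rn) (phi u w : Rn -> R) (x : Rn).

Definition sqnorm (x : Rn) : R := \sum_i x 0 i ^+ 2.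

Definition laplacian (w : Rn -> R) (x : Rn) : R :=
  \sum_i partial i (partial i w) x.

Lemma sqnorm_ge0 x : 0 <= sqnorm x.
Proof. by apply: sumr_ge0 => i _; exact: sqr_ge0. Qed.

Lemma sqr_enorm x : enorm x ^+ 2 = sqnorm x.
Proof. by rewrite /enorm sqr_sqrtr// sqnorm_ge0. Qed.

Lemma sqnorm_gt0 x : x != 0 -> 0 < sqnorm x.
Proof.
move=> x0; rewrite lt_neqAle sqnorm_ge0 andbT eq_sym; apply: contra x0.
rewrite psumr_eq0; last by move=> i _; exact: sqr_ge0.
move=> /allP h; apply/eqP/rowP => i; rewrite mxE; apply/eqP.
by rewrite -(sqrf_eq0 (x 0 i)); apply: h; rewrite mem_index_enum.
Qed.

Lemma sqr_coord_le x i : x 0 i ^+ 2 <= sqnorm x.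
Proof.
by rewrite /sqnorm (bigD1 i)//= lerDl sumr_ge0// => j _; exact: sqr_ge0.
Qed.

Lemma Ck_sqnorm k (U : set Rn) : open U -> Ck k U sqnorm.
Proof.
move=> oU; apply: Ck_sum => // i; under eq_fun do rewrite expr2.
by apply: CkM => //; exact: Ck_coord.
Qed.

Lemma Ck_inv k (U : set Rn) (f : Rn -> R) : open U -> (forall x, U x -> 0 < f x) ->
  Ck k U f -> Ck k U (fun x => (f x)^-1).
Proof.
move=> oU f0 Cf; apply: (@eq_Ck _ _ _ _ (fun x => expR (- 1 * ln (f x)))) => //.
  by move=> x Ux; rewrite mulN1r expRN lnK// posrE; exact: f0.
by apply: Ck_expR => //; apply: CkZ => //; exact: Ck_ln.
Qed.

Lemma test_function_bounded Omega phi :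
  test_function Omega phi -> bounded_support phi.
Proof.
case=> _ /compact_bounded[M [_ MP]] _; exists (`|M| + 1); first by rewrite ltr_pwDr.
move=> x xM; apply/eqP; apply: contraPT xM => phix; apply/negP; rewrite -ltNge.
suff : `|x| <= `|M| + 2^-1 by move=> ?; lra.
by apply: MP; [have := ler_norm M; lra|exact: subset_closure].
Qed.

Lemma test_function_near0 Omega phi x : test_function Omega phi ->
  ~ Omega x -> \forall y \near x, phi y = 0.
Proof.
move=> [_ _ sO] nO; pose K := closure [set x | phi x != 0].
have nK : (~` K) x by move=> /sO.
have oK : open (~` K) by apply: closed_openC; exact: closed_closure.
apply: filterS (open_nbhs_nbhs (conj oK nK)) => y yK.
by apply/eqP; apply: contra_notT yK => phiy; exact: subset_closure.
Qed.

Lemma test_function0 Omega phi x : test_function Omega phi -> ~ Omega x ->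
  phi x = 0.
Proof. by move=> tphi /(test_function_near0 tphi)/nbhs_singleton. Qed.

Lemma partial_test_functionM0 Omega phi g x i : test_function Omega phi ->
  ~ Omega x -> partial i (fun y => phi y * g y) x = 0.
Proof.
move=> tphi /(test_function_near0 tphi) phi0; rewrite /partial.
rewrite (@near_eq_derive _ _ _ _ (cst 0)) ?derive_cst//.
by apply: filterS phi0 => y ->; rewrite mul0r.
Qed.

Lemma partial_test_function0 Omega phi x i : test_function Omega phi ->
  ~ Omega x -> partial i phi x = 0.
Proof.
move=> tphi nO; rewrite -(partial_test_functionM0 (fun=> 1) i tphi nO).
by congr (partial _ _ _); apply/funext => y; rewrite mulr1.
Qed.

(** The product vanishes on the complement of the support of phi, which is open and
covers the space together with Omega, where both factors are of class C^k. *)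
Lemma Ck_test_functionM k Omega phi g : open Omega -> test_function Omega phi ->
  Ck k Omega g -> Ck k setT (fun x => phi x * g x).
Proof.
move=> oO [sphi cK sO] Cg; pose K := closure [set x | phi x != 0].
have oK : open (~` K) by apply: closed_openC; exact: closed_closure.
rewrite (_ : setT = Omega `|` ~` K); last first.
  apply/seteqP; split=> // x _; have [/sO|] := pselect (K x); by [left|right].
apply: Ck_union.
  by apply: CkM => //; apply: Ck_sub (smooth_Ck k sphi).
apply: (@eq_Ck _ _ _ _ (fun=> 0)) => //; last exact: Ck_cst.
move=> x xK; suff -> : phi x = 0 by rewrite mul0r.
by apply/eqP; apply: contra_notT xK => phix; exact: subset_closure.
Qed.

Lemma bounded_supportM f g : bounded_support f ->
  bounded_support (fun x : Rn => f x * g x).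
Proof. by move=> [M M0 fM]; exists M => // x /fM ->; rewrite mul0r. Qed.

Lemma bounded_supportD f g : bounded_support f -> bounded_support g ->
  bounded_support (fun x : Rn => f x + g x).
Proof.
move=> [M M0 fM] [M' M'0 gM]; exists (Num.max M M'); first by rewrite lt_max M0.
by move=> x; rewrite ge_max => /andP[xM xM2]; rewrite fM ?gM ?addr0.
Qed.

Lemma bounded_support_sum (f : 'I_n -> Rn -> R) :
  (forall i, bounded_support (f i)) ->
  bounded_support (fun x => \sum_i f i x).
Proof.
move=> sf; elim: (index_enum _) => [|i r IH].
  by under eq_fun do rewrite big_nil; exists 1.
by under eq_fun do rewrite big_cons; exact: bounded_supportD.
Qed.

Lemma Ck_continuousT (f : Rn -> R) k : Ck k setT f -> continuous f.
Proof. by move=> Cf x; exact: (Ck_continuous Cf). Qed.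

Lemma integral_divergence (G : 'I_n -> Rn -> R) :
  (forall i, Ck 1 setT (G i)) -> (forall i, bounded_support (G i)) ->
  [/\ mu.-integrable setT (EFin \o (fun x => \sum_i partial i (G i) x)) &
    (\int[mu]_x (\sum_i partial i (G i) x)%:E = 0)%E].
Proof.
move=> CG sG.
have cG i : continuous (partial i (G i)) by apply: Ck_continuousT; exact: Ck_partial (CG i).
have iG i : mu.-integrable setT (EFin \o partial i (G i)).
  by apply: bounded_support_integrable => //; exact: bounded_support_partial.
have E : (fun x => (\sum_i partial i (G i) x)%:E) =
    (fun x => \sum_i (partial i (G i) x)%:E)%E.
  by apply/funext => x; rewrite sumEFin.
split; first by rewrite /comp E; apply: integrable_sum => // i _; exact: iG.
rewrite E integral_sum// big1// => i _.
apply: integral_partial_eq0 => // x; exact: ((CG i).2 i).1.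
Qed.

Lemma eq_integral_test (Omega : set Rn) (f : Rn -> R) :
  (forall x, ~ Omega x -> f x = 0) ->
  (\int[mu]_(x in Omega) (f x)%:E = \int[mu]_x (f x)%:E)%E.
Proof.
move=> f0; rewrite integral_mkcond; congr (integral _ _ _); apply/funext => x.
rewrite patchE; case: ifPn => //; rewrite notin_setE => /f0 ->//.
Qed.

(** Here a, b, W, c, d stand for phi, grad phi, w, grad w and the pure second
derivatives of w. The difference of the two sides is at least |b - a c / W|^2,
by completing the square; the inner sum is div (phi^2 grad w / w). *)
Lemma supersolution_ineq (a W k : R) (b c d : 'I_n -> R) : 0 < W ->
  \sum_i d i <= - k * W ->
  k * a ^+ 2 <= \sum_i b i ^+ 2 -
    \sum_i (2 * a * b i * (c i * W^-1) + a ^+ 2 * (d i * W^-1 - c i ^+ 2 * W^- 2)).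
Proof.
move=> W0 dk; rewrite -sumrB.
have -> : \sum_i (b i ^+ 2 - (2 * a * b i * (c i * W^-1) +
    a ^+ 2 * (d i * W^-1 - c i ^+ 2 * W^- 2))) =
    \sum_i (b i - a * c i * W^-1) ^+ 2 - a ^+ 2 * W^-1 * \sum_i d i.
  rewrite mulr_sumr -sumrB; apply: eq_bigr => i _; field; exact: lt0r_neq0.
have h : 0 <= \sum_i (b i - a * c i / W) ^+ 2.
  by apply: sumr_ge0 => i _; exact: sqr_ge0.
have : a ^+ 2 * W^-1 * \sum_i d i <= a ^+ 2 * W^-1 * (- k * W).
  by apply: ler_wpM2l => //; rewrite mulr_ge0 ?sqr_ge0// invr_ge0 ltW.
have -> : a ^+ 2 * W^-1 * (- k * W) = - (k * a ^+ 2) by field; exact: lt0r_neq0.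
lra.
Qed.

Lemma continuous_energy phi : smooth phi ->
  continuous (fun x => \sum_i partial i phi x ^+ 2).
Proof.
move=> sphi; apply: (@Ck_continuousT _ 0); apply: Ck_sum; first exact: openT.
by move=> i; under eq_fun do rewrite expr2; apply: CkM; [exact: openT|..];
  exact: Ck_partial (smooth_Ck 1 sphi).
Qed.

Lemma bounded_support_energy phi : bounded_support phi ->
  bounded_support (fun x => \sum_i partial i phi x ^+ 2).
Proof.
move=> bphi; apply: bounded_support_sum => i; under eq_fun do rewrite expr2.
by apply: bounded_supportM; exact: bounded_support_partial.
Qed.

Lemma hardy_densityE phi x :
  phi x ^+ 2 / enorm x ^+ 2 = phi x * (phi x * (sqnorm x)^-1).
Proof. by rewrite sqr_enorm mulrA. Qed.

Lemma hardy_density_ge0 phi x : 0 <= phi x ^+ 2 / enorm x ^+ 2.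
Proof. by apply: mulr_ge0; rewrite ?invr_ge0; exact: sqr_ge0. Qed.

Lemma continuous_hardy_density Omega phi : open Omega ->
  (forall x, Omega x -> x != 0) -> test_function Omega phi ->
  continuous (fun x => phi x ^+ 2 / enorm x ^+ 2).
Proof.
move=> oO O0 tphi; under eq_fun do rewrite hardy_densityE.
apply: (@Ck_continuousT _ 0); apply: CkM; first exact: openT.
  by apply: smooth_Ck; case: tphi.
apply: (Ck_test_functionM oO tphi); apply: Ck_inv => //; last exact: Ck_sqnorm.
by move=> x Ox; apply: sqnorm_gt0; exact: O0.
Qed.

Lemma bounded_support_hardy_density phi : bounded_support phi ->
  bounded_support (fun x => phi x ^+ 2 / enorm x ^+ 2).
Proof.
by move=> bphi; under eq_fun do rewrite hardy_densityE; exact: bounded_supportM.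
Qed.

(** The inequality of [supersolution_ineq] is integrated; the field
phi^2 grad w / w is C^1 with compact support, so its divergence integrates to 0. *)
Theorem supersolution_hardy Omega (w : Rn -> R) (kappa : R) phi : open Omega ->
  (forall x, Omega x -> x != 0) -> 0 <= kappa ->
  Ck 2 Omega w -> (forall x, Omega x -> 0 < w x) ->
  (forall x, Omega x -> laplacian w x <= - (kappa / sqnorm x) * w x) ->
  test_function Omega phi ->
  (kappa%:E * \int[mu]_(x in Omega) (phi x ^+ 2 / enorm x ^+ 2)%:E <=
   \int[mu]_(x in Omega) (\sum_i partial i phi x ^+ 2)%:E)%E.
Proof.
move=> oO O0 k0 Cw w0 lapw tphi; have [sphi _ _] := tphi.
have Cphi k : Ck k setT phi by exact: smooth_Ck.
pose v i x := partial i w x * (w x)^-1.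
have Cv i : Ck 1 Omega (v i).
  by apply: CkM => //; [exact: Ck_partial Cw|apply: Ck_inv => //; exact: CkS].
(* The field phi^2 grad w / w. *)
pose G i x := phi x * (phi x * v i x).
have CG i : Ck 1 setT (G i).
  by apply: CkM => //; [exact: openT|exact: (Ck_test_functionM oO tphi)].
have sP := test_function_bounded tphi.
have sG i : bounded_support (G i) by exact: bounded_supportM.
have dG i x : Omega x -> partial i (G i) x =
    2 * phi x * partial i phi x * (partial i w x * (w x)^-1) +
    phi x ^+ 2 * (partial i (partial i w) x * (w x)^-1 -
                  partial i w x ^+ 2 * (w x)^- 2).
  move=> Ox; have wx := w0 _ Ox.
  have dphi := Ck_is_derive i (Cphi 1) (I : setT x).
  have dw := Ck_is_derive i Cw Ox.
  have ddw := Ck_is_derive i (Ck_partial i Cw) Ox.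
  have dinv : is_derive (w x) 1 (fun y : R => y^-1) (- (w x) ^- 2 *: 1).
    by apply: is_deriveV; exact: lt0r_neq0.
  have dv := is_derive_mul ddw (is_derive_comp dinv dw).
  have dGi := is_derive_mul dphi (is_derive_mul dphi dv).
  rewrite /partial; apply: etrans (derive_val (is_derive := dGi)) _.
  rewrite -/(partial i phi x) -/(partial i w x) -/(partial i (partial i w) x).
  by rewrite /GRing.scale /=; field; exact: lt0r_neq0.
have [iD ID] := integral_divergence CG sG.
pose F x := \sum_i partial i phi x ^+ 2.
have cF : continuous F by exact: continuous_energy.
have iF := bounded_support_integrable cF (bounded_support_energy sP).
pose H x := phi x ^+ 2 / enorm x ^+ 2.
have H0 x : 0 <= H x by exact: hardy_density_ge0.
have mH : measurable_fun setT H.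
  by apply: continuous_measurable_rV; exact: continuous_hardy_density tphi.
rewrite (@eq_integral_test Omega H); last first.
  by move=> x nO; rewrite /H hardy_densityE (test_function0 tphi nO) mul0r.
rewrite (@eq_integral_test Omega F); last first.
  move=> x nO; rewrite /F big1// => i _.
  by rewrite (partial_test_function0 i tphi nO) expr0n.
rewrite -ge0_integralZl_EFin//; last 2 first.
- by move=> x _; rewrite lee_fin.
- exact/measurable_EFinP.
rewrite -[leRHS]sube0 -ID -integralB_EFin//.
apply: ge0_le_integral => //.
- by move=> x _; rewrite lee_fin mulr_ge0.
- by apply/measurable_EFinP; exact: measurable_funM.
- apply/measurable_EFinP; apply: measurable_funB; apply: continuous_measurable_rV => //.
  apply: (@Ck_continuousT _ 0); apply: Ck_sum; first exact: openT.
  by move=> i; exact: Ck_partial (CG i).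
- move=> x _; rewrite -EFinM -EFinB lee_fin.
  have [Ox|nO] := pselect (Omega x).
    under [in leRHS]eq_bigr do rewrite dG//.
    have := supersolution_ineq (phi x) (fun i => partial i phi x)
      (fun i => partial i w x) (w0 _ Ox) (lapw _ Ox).
    by congr (_ <= _); rewrite /H hardy_densityE expr2; ring.
  rewrite /H hardy_densityE (test_function0 tphi nO) mul0r mulr0 big1 ?subr0.
    by apply: sumr_ge0 => i _; exact: sqr_ge0.
  by move=> i _; exact: (partial_test_functionM0 _ i tphi nO).
Qed.

End test_functions.

(** * From test functions to the Sobolev space *)

Section closure.
Variables (R : realType) (n : nat).
Local Notation Rn := 'rV[R]_n.
Local Notation mu := (lebesgue_rV R n).
Implicit Types (Omega : set Rn) (x : Rn).

(** The difference of the two sides is (t b + (b - a))^2 / t. *)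
Lemma sqr_le_weighted (t a b : R) : 0 < t ->
  a ^+ 2 <= (1 + t) * b ^+ 2 + (1 + t^-1) * (b - a) ^+ 2.
Proof.
move=> t0.
have -> : (1 + t) * b ^+ 2 + (1 + t^-1) * (b - a) ^+ 2 =
    a ^+ 2 + t^-1 * (t * b + (b - a)) ^+ 2 by field; exact: lt0r_neq0.
by rewrite lerDl mulr_ge0 ?sqr_ge0// invr_ge0 ltW.
Qed.

Lemma measurable_inv_sqnorm Omega : measurable Omega -> (forall x, Omega x -> x != 0) ->
  measurable_fun Omega (fun x => (sqnorm x)^-1).
Proof.
move=> mO O0.
apply: (eq_measurable_fun (fun x => expR (- ln (sqnorm x)))).
  move=> x; rewrite inE => Ox; rewrite expRN lnK// posrE.
  by apply: sqnorm_gt0; exact: O0.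
apply: measurableT_comp => //; apply: measurableT_comp => //.
apply: measurableT_comp => //; apply: measurable_funTS.
apply: continuous_measurable_rV; apply: (@Ck_continuousT _ _ _ 0).
exact/Ck_sqnorm/openT.
Qed.

(** Under a bounded weight, H^1 convergence of test functions passes to the limit on
both sides. Each squared error is absorbed by [sqr_le_weighted] with a parameter t that
tends to 0 after the approximation index has tended to infinity. *)
Lemma hardy_cutoff Omega u g (V : Rn -> R) (m : R) (kappa : R) : open Omega ->
  0 <= kappa -> measurable_fun Omega V ->
  (forall x, Omega x -> 0 <= V x /\ V x <= (sqnorm x)^-1 /\ V x <= m) ->
  (forall x, Omega x -> x != 0) ->
  (forall phi, test_function Omega phi ->
    (kappa%:E * \int[mu]_(x in Omega) (phi x ^+ 2 / enorm x ^+ 2)%:E <=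
     \int[mu]_(x in Omega) (\sum_i partial i phi x ^+ 2)%:E)%E) ->
  sobolev_H10 Omega u g ->
  (\int[mu]_(x in Omega) (kappa * (V x * u x ^+ 2))%:E <=
   \int[mu]_(x in Omega) (enorm (g x) ^+ 2)%:E)%E.
Proof.
move=> oO k0 mV hV O0 hphi [[[mu_ iu] g2 _] [phi [tphi phiu]]].
have mO := open_measurable_rV oO.
have mg i : measurable_fun Omega (fun x => g x 0 i) by case: (g2 i).
pose Ng x := \sum_i g x 0 i ^+ 2.
have mNg : measurable_fun Omega Ng.
  by apply: measurable_sum => i; exact: measurable_funX.
have -> : (\int[mu]_(x in Omega) (enorm (g x) ^+ 2)%:E =
    \int[mu]_(x in Omega) (Ng x)%:E)%E.
  by apply: eq_integral => x _; rewrite sqr_enorm.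
have Ng0 x : 0 <= Ng x by exact: sqnorm_ge0.
pose e k x := (phi k x - u x) ^+ 2 + \sum_i (partial i (phi k) x - g x 0 i) ^+ 2.
have sphi k : smooth (phi k) by case: (tphi k).
have mphi k : measurable_fun Omega (phi k).
  apply: measurable_funTS; apply: continuous_measurable_rV; apply: (@Ck_continuousT _ _ _ 0).
  exact: smooth_Ck.
have mdphi k i : measurable_fun Omega (partial i (phi k)).
  apply: measurable_funTS; apply: continuous_measurable_rV; apply: (@Ck_continuousT _ _ _ 0).
  exact: Ck_partial (smooth_Ck 1 (sphi k)).
have me k : measurable_fun Omega (e k).
  apply: measurable_funD; first by apply: measurable_funX; exact: measurable_funB.
  by apply: measurable_sum => i; apply: measurable_funX; exact: measurable_funB.
have se0 k x : 0 <= \sum_i (partial i (phi k) x - g x 0 i) ^+ 2.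
  by apply: sumr_ge0 => i _; exact: sqr_ge0.
have e0 k x : 0 <= e k x by rewrite addr_ge0 ?sqr_ge0.
have m0 : 0 <= m \/ Omega = set0.
  have [eO|/set0P[x Ox]] := eqVneq Omega set0; first by right.
  by left; have [Vx0 [_ Vxm]] := hV _ Ox; exact: le_trans Vx0 Vxm.
case: m0 => [m0|->]; last by rewrite !integral_set0.
set A := (\int[mu]_(x in Omega) (kappa * (V x * u x ^+ 2))%:E)%E.
set B := (\int[mu]_(x in Omega) (Ng x)%:E)%E.
have Bfin : (B < +oo)%E.
  rewrite /B /Ng; under eq_integral do rewrite -sumEFin.
  rewrite ge0_integral_sum//.
  - by apply: lte_sum_pinfty => i _; case: (g2 i).
  - by move=> i; apply/measurable_EFinP; exact: measurable_funX.
  - by move=> i x _; rewrite lee_fin sqr_ge0.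
have B0 : (0 <= B)%E by apply: integral_ge0 => x _; rewrite lee_fin.
have mint (f : Rn -> R) (c : R) : 0 <= c -> measurable_fun Omega f ->
    (forall x, 0 <= f x) ->
    (\int[mu]_(x in Omega) (c * f x)%:E = c%:E * \int[mu]_(x in Omega) (f x)%:E)%E.
  move=> c0 mf f0; under eq_integral do rewrite EFinM.
  rewrite ge0_integralZl_EFin//; first by move=> x _; rewrite lee_fin.
  exact/measurable_EFinP.
have mintD (f h : Rn -> R) (c d : R) : 0 <= c -> 0 <= d ->
    measurable_fun Omega f -> measurable_fun Omega h ->
    (forall x, 0 <= f x) -> (forall x, 0 <= h x) ->
    (\int[mu]_(x in Omega) (c * f x + d * h x)%:E =
     c%:E * \int[mu]_(x in Omega) (f x)%:E + d%:E * \int[mu]_(x in Omega) (h x)%:E)%E.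
  move=> c0 d0 mf mh f0 h0; under eq_integral do rewrite EFinD.
  rewrite ge0_integralD ?mint//.
  - by move=> x _; rewrite lee_fin mulr_ge0.
  - by apply/measurable_EFinP; exact: measurable_funM.
  - by move=> x _; rewrite lee_fin mulr_ge0.
  - by apply/measurable_EFinP; exact: measurable_funM.
have key t k : 0 < t -> (A <= ((1 + t) ^+ 2)%:E * B +
    ((1 + t) * (1 + t^-1) + kappa * m * (1 + t^-1))%:E *
      \int[mu]_(x in Omega) (e k x)%:E)%E.
  move=> t0; have t'0 : 0 < t^-1 by rewrite invr_gt0.
  have c1 : 0 <= 1 + t by rewrite addr_ge0// ltW.
  have c2 : 0 <= 1 + t^-1 by rewrite addr_ge0// ltW.
  have c3 : 0 <= (1 + t) * kappa by exact: mulr_ge0.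
  have c4 : 0 <= kappa * m * (1 + t^-1) by rewrite !mulr_ge0.
  have c5 : 0 <= (1 + t) * (1 + t^-1) by exact: mulr_ge0.
  pose P x := phi k x ^+ 2 / enorm x ^+ 2.
  pose D x := \sum_i partial i (phi k) x ^+ 2.
  have P0 x : 0 <= P x by rewrite mulr_ge0 ?invr_ge0 ?sqr_ge0.
  have D0 x : 0 <= D x by apply: sumr_ge0 => i _; exact: sqr_ge0.
  have mP : measurable_fun Omega P.
    apply: measurable_funM; first exact: measurable_funX.
    under eq_fun do rewrite sqr_enorm; exact: measurable_inv_sqnorm.
  have mD : measurable_fun Omega D.
    by apply: measurable_sum => i; exact: measurable_funX.
  (* First u is replaced by phi k, then grad (phi k) by g. *)
  apply: (@le_trans _ _ ((1 + t)%:E * (kappa%:E * \int[mu]_(x in Omega) (P x)%:E) +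
      (kappa * m * (1 + t^-1))%:E * \int[mu]_(x in Omega) (e k x)%:E)%E).
    rewrite muleA -EFinM -mintD//.
    apply: ge0_le_integral => //.
    - move=> x /hV[V0 _]; rewrite lee_fin; apply: mulr_ge0 => //.
      by apply: mulr_ge0 => //; exact: sqr_ge0.
    - apply/measurable_EFinP; apply: measurable_funM => //.
      by apply: measurable_funM => //; exact: measurable_funX.
    - apply/measurable_EFinP; apply: measurable_funD; apply: measurable_funM => //.
    - move=> x Ox; rewrite lee_fin; have [V0 [V1 V2]] := hV _ Ox.
      have h1 := sqr_le_weighted (u x) (phi k x) t0.
      apply: (@le_trans _ _ (kappa * (V x *
        ((1 + t) * phi k x ^+ 2 + (1 + t^-1) * (phi k x - u x) ^+ 2)))).
        by rewrite !ler_wpM2l.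
      rewrite [leLHS](_ : _ = kappa * (V x * ((1 + t) * phi k x ^+ 2)) +
        kappa * (V x * ((1 + t^-1) * (phi k x - u x) ^+ 2))); last by ring.
      apply: lerD.
        rewrite [leRHS](_ : _ = kappa * ((sqnorm x)^-1 * ((1 + t) * phi k x ^+ 2))).
          rewrite ler_wpM2l// ler_wpM2r//.
          by apply: mulr_ge0 => //; exact: sqr_ge0.
        by rewrite /P sqr_enorm; ring.
      rewrite [leRHS](_ : _ = kappa * (m * ((1 + t^-1) * e k x))); last by ring.
      rewrite ler_wpM2l// ler_pM// //; first by apply: mulr_ge0 => //; exact: sqr_ge0.
      by rewrite ler_wpM2l// lerDl.
  have E0 : (0 <= \int[mu]_(x in Omega) (e k x)%:E)%E.
    by apply: integral_ge0 => x _; rewrite lee_fin.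
  rewrite (EFinD (_ * _)) ge0_muleDl ?lee_fin// addeA; apply: leeD => //.
  rewrite expr2 !EFinM -!muleA -ge0_muleDr ?mule_ge0//.
    apply: lee_wpmul2l; first by rewrite lee_fin.
    apply: le_trans (hphi _ (tphi k)) _; rewrite -mintD//.
    apply: ge0_le_integral => //.
    + by move=> x _; rewrite lee_fin; exact: D0.
    + exact/measurable_EFinP.
    + by apply/measurable_EFinP; apply: measurable_funD; apply: measurable_funM => //.
    + move=> x _; rewrite lee_fin.
      apply: (@le_trans _ _ (\sum_i ((1 + t) * g x 0 i ^+ 2 +
        (1 + t^-1) * (partial i (phi k) x - g x 0 i) ^+ 2))).
        apply: ler_sum => i _; rewrite -(sqrrN (_ - g x 0 i)) opprB.
        exact: sqr_le_weighted.
      rewrite big_split/= -!mulr_sumr lerD// ler_wpM2l//.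
      by rewrite /e lerDr sqr_ge0.
have key2 t : 0 < t -> (A <= ((1 + t) ^+ 2)%:E * B)%E.
  move=> t0; apply/lee_addgt0Pr => d d0.
  pose C := ((1 + t) * (1 + t^-1) + kappa * m * (1 + t^-1)).
  have C0 : 0 < C.
    have t'0 : 0 < t^-1 by rewrite invr_gt0.
    by rewrite ltr_wpDr ?mulr_ge0 ?mulr_gt0 ?addr_gt0 ?addr_ge0// ltW.
  have : \forall k \near \oo, (\int[mu]_(x in Omega) (e k x)%:E < (d / C)%:E)%E.
    have dC : (0 < (d / C)%:E)%E by rewrite lte_fin divr_gt0.
    exact: (phiu _ (open_ereal_lt' dC)).
  case=> k _ /(_ k (leqnn k)) /= ek; apply: le_trans (key t k t0) _.
  rewrite leeD2l// -/C; apply: (@le_trans _ _ (C%:E * (d / C)%:E)%E).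
    by apply: lee_wpmul2l; [rewrite lee_fin ltW|exact: ltW].
  by rewrite -EFinM lee_fin mulrC divfK// lt0r_neq0.
(* The factor (1 + t)^2 exceeds 1 by at most 3 t for t <= 1. *)
clear key; move: Bfin B0 key2; case: B => // b _; rewrite lee_fin => b0 key2.
apply/lee_addgt0Pr => d d0.
pose t := Num.min 1 (d / (3 * (b + 1))).
have t0 : 0 < t by rewrite lt_min ltr01 divr_gt0// mulr_gt0// ltr_pwDr.
apply: le_trans (key2 t t0) _; rewrite -EFinM -EFinD lee_fin.
have t1 : t <= 1 by rewrite ge_min lexx.
have t2 : t * (3 * (b + 1)) <= d.
  by rewrite -ler_pdivlMr ?ge_min ?lexx ?orbT// mulr_gt0// ltr_pwDr.
have : t * t * b <= t * b by rewrite ler_wpM2r// ler_piMr// ltW.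
have : 0 <= t * b by rewrite mulr_ge0// ltW.
rewrite expr2; nra.
Qed.

End closure.

(** * Bounds for the Hardy constant *)

Section hardy_bounds.
Variables (R : realType) (n : nat).
Local Notation Rn := 'rV[R]_n.
Local Notation mu := (lebesgue_rV R n).
Implicit Types (Omega : set Rn) (x : Rn) (f u phi : Rn -> R).

(** Monotone convergence along the truncated weights min (1/|x|^2, m). *)
Lemma hardy_H10 Omega u g (kappa : R) : open Omega -> 0 <= kappa ->
  (forall x, Omega x -> x != 0) ->
  (forall phi, test_function Omega phi ->
    (kappa%:E * \int[mu]_(x in Omega) (phi x ^+ 2 / enorm x ^+ 2)%:E <=
     \int[mu]_(x in Omega) (\sum_i partial i phi x ^+ 2)%:E)%E) ->
  sobolev_H10 Omega u g ->
  (kappa%:E * \int[mu]_(x in Omega) (u x ^+ 2 / enorm x ^+ 2)%:E <=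
   \int[mu]_(x in Omega) (enorm (g x) ^+ 2)%:E)%E.
Proof.
move=> oO k0 O0 hphi hug; have [[[mu_ _] _ _] _] := hug.
have mO := open_measurable_rV oO.
pose V (m : nat) x := Num.min (sqnorm x)^-1 m%:R.
have V0 m x : 0 <= V m x by rewrite le_min invr_ge0 sqnorm_ge0 ler0n.
have mV0 := measurable_inv_sqnorm mO O0.
have mV m : measurable_fun Omega (V m).
  by apply: measurable_minr => //; exact: measurable_cst.
pose f m x := (kappa * (V m x * u x ^+ 2))%:E.
have mf m : measurable_fun Omega (f m).
  apply/measurable_EFinP; apply: measurable_funM => //.
  by apply: measurable_funM => //; exact: measurable_funX.
have f0 m x : Omega x -> (0 <= f m x)%E.
  by move=> _; rewrite lee_fin; apply: mulr_ge0 => //;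
    apply: mulr_ge0 => //; exact: sqr_ge0.
have ndf x : Omega x -> {homo f^~ x : m k / (m <= k)%N >-> (m <= k)%E}.
  move=> _ m k mk; rewrite lee_fin ler_wpM2l// ler_wpM2r ?sqr_ge0//.
  by rewrite le_min !ge_min lexx/= ler_nat mk orbT.
have fE x : limn (f^~ x) = (kappa%:E * (u x ^+ 2 / enorm x ^+ 2)%:E)%E.
  apply: cvg_lim => //; apply: cvg_near_cst.
  exists (Num.truncn (sqnorm x)^-1).+1 => // m /= mN.
  rewrite /f /V min_l.
    by rewrite sqr_enorm -EFinM mulrC [in RHS](mulrC (u x ^+ 2)) (mulrC kappa).
  by apply: ltW; apply: lt_le_trans (truncnS_gt _) _; rewrite ler_nat.
have <- : (\int[mu]_(x in Omega) limn (f^~ x) =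
    kappa%:E * \int[mu]_(x in Omega) (u x ^+ 2 / enorm x ^+ 2)%:E)%E.
  rewrite -ge0_integralZl_EFin//; first by apply: eq_integral => x _; exact: fE.
  - by move=> x _; rewrite lee_fin; exact: hardy_density_ge0.
  - apply/measurable_EFinP; apply: measurable_funM; first exact: measurable_funX.
    by under eq_fun do rewrite sqr_enorm.
apply: cvge_le (cvg_monotone_convergence mO mf f0 ndf); apply: nearW => m.
apply: (@hardy_cutoff _ _ _ _ _ _ m%:R) => //.
by move=> x _; rewrite V0 /V !ge_min !lexx orbT.
Qed.

Lemma hardy_density_eq0 Omega u : measurable Omega ->
  (forall x, Omega x -> x != 0) -> measurable_fun Omega u ->
  (\int[mu]_(x in Omega) (u x ^+ 2 / enorm x ^+ 2)%:E = 0)%E ->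
  {ae mu, forall x, Omega x -> u x = 0}.
Proof.
move=> mO O0 mu_ I0.
have mH : measurable_fun Omega (fun x => (u x ^+ 2 / enorm x ^+ 2)%:E).
  apply/measurable_EFinP; apply: measurable_funM; first exact: measurable_funX.
  by under eq_fun do rewrite sqr_enorm; exact: measurable_inv_sqnorm.
have := (ae_eq_integral_abs mu mO mH).1.
have -> : (\int[mu]_(x in Omega) `|(u x ^+ 2 / enorm x ^+ 2)%:E| = 0)%E.
  rewrite -[RHS]I0; apply: eq_integral => x _.
  by rewrite gee0_abs// lee_fin hardy_density_ge0.
move=> /(_ erefl); apply: filterS => x h Ox; have := h Ox => -[].
rewrite sqr_enorm => /eqP; rewrite mulf_eq0 sqrf_eq0 invr_eq0.
by rewrite (gt_eqF (sqnorm_gt0 (O0 _ Ox))) orbF => /eqP.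
Qed.

(** The energy is finite on H^1, so the Hardy inequality forces the denominator to
be finite; it is positive because u does not vanish almost everywhere. Hence
the quotient is a genuine one. *)
Theorem hardy_constant_ge Omega (kappa : R) : open Omega -> 0 < kappa ->
  (forall x, Omega x -> x != 0) ->
  (forall phi, test_function Omega phi ->
    (kappa%:E * \int[mu]_(x in Omega) (phi x ^+ 2 / enorm x ^+ 2)%:E <=
     \int[mu]_(x in Omega) (\sum_i partial i phi x ^+ 2)%:E)%E) ->
  (kappa%:E <= hardy_constant Omega)%E.
Proof.
move=> oO k0 O0 hphi; apply: le_ereal_inf_tmp => _ [u [g [hug u0 ->]]].
have := hardy_H10 oO (ltW k0) O0 hphi hug; rewrite /hardy_quotient.
have [[[mu_ _] hg _] _] := hug.
have mO := open_measurable_rV oO.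
set D := integral _ _ (fun x => (u x ^+ 2 / _)%:E).
set E := integral _ _ _.
have D0 : (0 <= D)%E.
  by apply: integral_ge0 => x _; rewrite lee_fin hardy_density_ge0.
have Dn0 : D != 0%E.
  by apply/eqP => D00; apply: u0; exact: hardy_density_eq0.
have Efin : (E < +oo)%E.
  rewrite /E; under eq_integral do rewrite sqr_enorm /sqnorm -sumEFin.
  rewrite ge0_integral_sum//.
  - by apply: lte_sum_pinfty => i _; case: (hg i).
  - move=> i; apply/measurable_EFinP; apply: measurable_funX.
    by case: (hg i).
  - by move=> i x _; rewrite lee_fin sqr_ge0.
move: D D0 Dn0 => [d| |]//; last first.
  by move=> _ _; rewrite gt0_muley ?lte_fin// leye_eq => /eqP E1; rewrite E1 in Efin.
rewrite lee_fin eqe => d0 dn0; have {}d0 : 0 < d by rewrite lt_neqAle eq_sym dn0.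
by rewrite inver (negbTE dn0) -lee_pdivlMr.
Qed.

Lemma integral_by_parts Omega f phi i : test_function Omega f ->
  test_function Omega phi ->
  (\int[mu]_(x in Omega) (f x * partial i phi x)%:E =
   - \int[mu]_(x in Omega) (partial i f x * phi x)%:E)%E.
Proof.
move=> tf tphi.
have [Cf Cphi] : (forall k, Ck k setT f) /\ (forall k, Ck k setT phi).
  by split=> k; apply: smooth_Ck; [case: tf|case: tphi].
have [sf sphi] := (test_function_bounded tf, test_function_bounded tphi).
rewrite (@eq_integral_test _ _ Omega (fun x => f x * partial i phi x)); last first.
  by move=> x nO; rewrite (test_function0 tf nO) mul0r.
rewrite (@eq_integral_test _ _ Omega (fun x => partial i f x * phi x)); last first.
  by move=> x nO; rewrite (test_function0 tphi nO) mulr0.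
pose G x := f x * phi x.
have CG : Ck 1 setT G by apply: CkM => //; exact: openT.
have dG : (fun x => (partial i G x)%:E) =
    (fun x => (partial i f x * phi x)%:E + (f x * partial i phi x)%:E)%E.
  apply/funext => x; rewrite -EFinD; congr EFin.
  apply: (derive_val (is_derive := is_derive_mul (Ck_is_derive i (Cf 1) (I : setT x))
    (Ck_is_derive i (Cphi 1) (I : setT x)))).
have : (\int[mu]_x (partial i G x)%:E = 0)%E.
  apply: integral_partial_eq0; first exact: bounded_supportM.
    by move=> x; exact: (CG.2 i).1.
  by apply: (@Ck_continuousT _ _ _ 0); exact: Ck_partial CG.
have i1 : mu.-integrable setT (EFin \o (fun x => partial i f x * phi x)).
  apply: bounded_support_integrable.
    apply: (@Ck_continuousT _ _ _ 0); apply: CkM => //; first exact: openT.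
    exact: Ck_partial (Cf 1).
  by apply: bounded_supportM; exact: bounded_support_partial.
have i2 : mu.-integrable setT (EFin \o (fun x => f x * partial i phi x)).
  apply: bounded_support_integrable; last exact: bounded_supportM.
  apply: (@Ck_continuousT _ _ _ 0); apply: CkM => //; first exact: openT.
  exact: Ck_partial (Cphi 1).
rewrite dG integralD_EFin//.
have : (\int[mu]_x (partial i f x * phi x)%:E)%E \is a fin_num.
  exact: integrable_fin_num i1.
have : (\int[mu]_x (f x * partial i phi x)%:E)%E \is a fin_num.
  exact: integrable_fin_num i2.
move: (\int[mu]_x _)%E => [a| |]// _; move: (\int[mu]_x _)%E => [b| |]// _ [ab].
by congr EFin; lra.
Qed.

Lemma test_function_L2 Omega f : open Omega -> continuous f -> bounded_support f ->
  (forall x, ~ Omega x -> f x = 0) -> L2 Omega f.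
Proof.
move=> oO cf sf f0; split; first by apply: measurable_funTS; exact: continuous_measurable_rV.
rewrite (@eq_integral_test _ _ Omega (fun x => f x ^+ 2)); last first.
  by move=> x /f0 ->; rewrite expr0n.
have : mu.-integrable setT (EFin \o (fun x => f x ^+ 2)).
  under eq_fun do rewrite expr2.
  apply: bounded_support_integrable; last exact: bounded_supportM.
  by move=> x; apply: (continuousM (cf x) (cf x)).
move=> /integrableP[_]; under eq_integral => x _ do
  rewrite /= ger0_norm ?sqr_ge0//.
by [].
Qed.

Lemma test_function_H10 Omega phi : open Omega -> test_function Omega phi ->
  sobolev_H10 Omega phi (fun x => \row_i partial i phi x).
Proof.
move=> oO tphi; have [sphi _ _] := tphi.
have bphi := test_function_bounded tphi.
split; last first.
  exists (fun=> phi); split=> //.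
  under eq_fun do under eq_integral => x _ do
    under eq_bigr do rewrite mxE subrr expr0n/=.
  under eq_fun do under eq_integral do rewrite subrr expr0n/= big1// addr0.
  by under eq_fun do rewrite integral0; exact: cvg_cst.
split.
- apply: test_function_L2 => //; last by move=> x; exact: test_function0.
  by apply: (@Ck_continuousT _ _ _ 0); exact: smooth_Ck.
- move=> i; under eq_fun do rewrite mxE; apply: test_function_L2 => //.
  + apply: (@Ck_continuousT _ _ _ 0); exact: Ck_partial (smooth_Ck 1 sphi).
  + exact: bounded_support_partial.
  + by move=> x; exact: partial_test_function0.
- move=> psi tpsi i; under [in RHS]eq_integral do rewrite mxE.
  exact: integral_by_parts.
Qed.

(** A test function belongs to H^1_0 with its classical gradient; if it is not
identically zero it is nonzero on a nonempty open set, which has positive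
measure. *)
Theorem hardy_constant_le Omega phi (kappa : R) : open Omega ->
  (forall x, Omega x -> x != 0) -> test_function Omega phi ->
  (exists x, phi x != 0) ->
  (\int[mu]_(x in Omega) (\sum_i partial i phi x ^+ 2)%:E <=
   kappa%:E * \int[mu]_(x in Omega) (phi x ^+ 2 / enorm x ^+ 2)%:E)%E ->
  (hardy_constant Omega <= kappa%:E)%E.
Proof.
move=> oO O0 tphi [x0 phix0] hphi.
have mO := open_measurable_rV oO.
have [sphi _ _] := tphi; have bphi := test_function_bounded tphi.
have cphi : continuous phi by apply: (@Ck_continuousT _ _ _ 0); exact: smooth_Ck.
have nae : ~ {ae mu, forall x, Omega x -> phi x = 0}.
  case=> A [mA A0 sA].
  pose U := [set x | phi x != 0].
  have oU : open U.
    rewrite /U (_ : [set x | _] = phi @^-1` [set y | y != 0])//.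
    by apply: open_comp; [move=> x _; exact: cphi|exact: open_neq].
  have : (0 < mu U)%E by apply: lebesgue_rV_open_gt0 => //; exists x0.
  rewrite ltNge => /negP; apply; rewrite -A0; apply: le_measure; rewrite ?inE//.
    exact: open_measurable_rV.
  move=> x Ux; apply: sA => /= h; have Ox : Omega x.
    apply: contrapT => nO; move: Ux.
    by rewrite /U/= (test_function0 tphi nO) eqxx.
  by move: Ux; rewrite /U/= h// eqxx.
pose g x := \row_i partial i phi x : Rn.
apply: (@le_trans _ _ (hardy_quotient Omega phi g)).
  by apply: ereal_inf_lbound; exists phi, g; split=> //; exact: test_function_H10.
have gE : (\int[mu]_(x in Omega) (enorm (g x) ^+ 2)%:E =
    \int[mu]_(x in Omega) (\sum_i partial i phi x ^+ 2)%:E)%E.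
  apply: eq_integral => x _; rewrite sqr_enorm /sqnorm.
  by under eq_bigr do rewrite mxE.
rewrite /hardy_quotient gE; move: hphi.
have : (\int[mu]_(x in Omega) (phi x ^+ 2 / enorm x ^+ 2)%:E \is a fin_num)%E.
  rewrite (@eq_integral_test _ _ Omega (fun x => phi x ^+ 2 / enorm x ^+ 2)).
    apply: integrable_fin_num => //; apply: bounded_support_integrable.
      exact: continuous_hardy_density tphi.
    exact: bounded_support_hardy_density.
  by move=> x nO; rewrite (test_function0 tphi nO) expr0n mul0r.
have : (0 <= \int[mu]_(x in Omega) (phi x ^+ 2 / enorm x ^+ 2)%:E)%E.
  by apply: integral_ge0 => x _; rewrite lee_fin hardy_density_ge0.
have : (\int[mu]_(x in Omega) (phi x ^+ 2 / enorm x ^+ 2)%:E != 0)%E.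
  apply/eqP => I0; apply: nae; apply: hardy_density_eq0 => //.
  by apply: measurable_funTS; exact: continuous_measurable_rV.
move: (\int[mu]_(x in Omega) (phi x ^+ 2 / _)%:E)%E => [d| |]//.
rewrite lee_fin eqe => dn0 d0 _; have {}d0 : 0 < d by rewrite lt_neqAle eq_sym dn0.
by rewrite inver (negbTE dn0) -lee_pdivrMr.
Qed.

(** |grad phi|^2 = div (phi grad phi) - phi Delta phi, and the divergence integrates
to 0. *)
Theorem subsolution_energy Omega phi (kappa : R) : open Omega ->
  (forall x, Omega x -> x != 0) -> test_function Omega phi -> 0 <= kappa ->
  (forall x, Omega x ->
    - (phi x * laplacian phi x) <= kappa * (phi x ^+ 2 / sqnorm x)) ->
  (\int[mu]_(x in Omega) (\sum_i partial i phi x ^+ 2)%:E <=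
   kappa%:E * \int[mu]_(x in Omega) (phi x ^+ 2 / enorm x ^+ 2)%:E)%E.
Proof.
move=> oO O0 tphi k0 hphi.
have mO := open_measurable_rV oO.
have [sphi _ _] := tphi; have bphi := test_function_bounded tphi.
have Cphi k : Ck k setT phi by exact: smooth_Ck.
pose G i x := phi x * partial i phi x.
have CG i : Ck 1 setT (G i).
  by apply: CkM => //; [exact: openT|exact: Ck_partial (Cphi 2)].
have sG i : bounded_support (G i) by exact: bounded_supportM.
have [iD ID] := integral_divergence CG sG.
have dG x : \sum_i partial i (G i) x =
    \sum_i partial i phi x ^+ 2 + phi x * laplacian phi x.
  rewrite mulr_sumr -big_split/=; apply: eq_bigr => i _.
  have Tx : setT x by [].
  have dGi := is_derive_mul (Ck_is_derive i (Cphi 1) Tx)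
    (Ck_is_derive i (Ck_partial i (Cphi 2)) Tx).
  by rewrite [LHS](derive_val (is_derive := dGi)) expr2.
pose H x := phi x ^+ 2 / enorm x ^+ 2.
have cH : continuous H by exact: continuous_hardy_density tphi.
have iH : mu.-integrable setT (EFin \o H).
  by apply: bounded_support_integrable => //; exact: bounded_support_hardy_density.
have iH' : mu.-integrable setT (EFin \o (fun x => kappa * H x)).
  by rewrite (_ : _ \o _ = (fun x => kappa%:E * (EFin \o H) x)%E)//; exact: integrableZl.
rewrite (@eq_integral_test _ _ Omega H); last first.
  by move=> x nO; rewrite /H (test_function0 tphi nO) expr0n mul0r.
rewrite (@eq_integral_test _ _ Omega (fun x => \sum_i partial i phi x ^+ 2)); last first.
  by move=> x nO; rewrite big1// => i _; rewrite (partial_test_function0 i tphi nO) expr0n.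
rewrite -ge0_integralZl_EFin//; last 2 first.
- by move=> x _; rewrite lee_fin hardy_density_ge0.
- by apply/measurable_EFinP; exact: continuous_measurable_rV.
rewrite -[leRHS]adde0 -ID -integralD_EFin//.
apply: ge0_le_integral => //.
- by move=> x _; rewrite lee_fin; apply: sumr_ge0 => i _; exact: sqr_ge0.
- by apply/measurable_EFinP; apply: continuous_measurable_rV; exact: continuous_energy.
- apply/measurable_EFinP; apply: measurable_funD.
    by apply: measurable_funM => //; exact: continuous_measurable_rV.
  apply: continuous_measurable_rV; apply: (@Ck_continuousT _ _ _ 0).
  by apply: Ck_sum => [|i]; [exact: openT|exact: Ck_partial (CG i)].
- move=> x _; rewrite -EFinD lee_fin dG.
  have [Ox|nO] := pselect (Omega x); last first.
    by rewrite (test_function0 tphi nO) mul0r addr0 lerDr mulr_ge0 ?hardy_density_ge0.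
  by have := hphi _ Ox; rewrite /H sqr_enorm; lra.
Qed.

End hardy_bounds.

(** * A flat function, and the Laplacian in polar form *)

Section flatexp.
Variable R : realType.
Implicit Types (p : {poly R}) (y z : R).

(** The functions y |-> p(1/y) exp(-1/y), extended by 0 to y <= 0, form a family that
is closed under differentiation: p is replaced by X^2 (p - p'). *)
Definition flat p y : R := if 0 < y then p.[y^-1] * expR (- y^-1) else 0.

Definition flatexp := flat 1%:P.

(** The rate a is arbitrary so that it can be halved each time the degree grows: one
half of the exponential absorbs the factor z. *)
Lemma poly_expR_bound p (a : R) : 0 < a ->
  exists2 C : R, 0 <= C & forall z, 0 <= z -> `|p.[z]| <= C * expR (a * z).
Proof.
elim/poly_ind: p a => [|p c IH] a a0.
  by exists 0 => // z _; rewrite horner0 normr0 mul0r.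
have [|C C0 hC] := IH (a / 2); first by rewrite divr_gt0.
exists (C * (2 / a) + `|c|).
  by rewrite addr_ge0// mulr_ge0// ltW// divr_gt0.
move=> z z0; rewrite hornerMXaddC (le_trans (ler_normD _ _))// mulrDl lerD//.
  rewrite normrM (ger0_norm z0).
  have -> : expR (a * z) = expR (a / 2 * z) * expR (a / 2 * z).
    by rewrite -expRD; congr expR; lra.
  have h2 : z <= 2 / a * expR (a / 2 * z).
    have := expR_ge1Dx (a / 2 * z).
    rewrite -(ler_pM2l (_ : 0 < 2 / a)) ?divr_gt0//.
    apply: le_trans; rewrite mulrDr mulr1.
    have -> : 2 / a * (a / 2 * z) = z by field; exact: lt0r_neq0.
    by rewrite lerDr ltW// divr_gt0.
  apply: (@le_trans _ _ ((C * expR (a / 2 * z)) * (2 / a * expR (a / 2 * z)))).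
    by apply: ler_pM => //; exact: hC.
  by rewrite le_eqVlt; apply/orP; left; apply/eqP; ring.
by rewrite ler_peMr// -expR0 ler_expR mulr_ge0// ltW.
Qed.

(** A quadratic bound at 0 gives at once continuity and a zero derivative there. *)
Lemma flat_sqr_bound p : exists2 C : R, 0 <= C & forall y, `|flat p y| <= C * y ^+ 2.
Proof.
have [C C0 hC] := poly_expR_bound ('X ^+ 2 * p) ltr01.
exists C => // y; rewrite /flat; case: ifPn => y0; last first.
  by rewrite normr0 mulr_ge0// sqr_ge0.
have yi : 0 < y^-1 by rewrite invr_gt0.
have := hC _ (ltW yi); rewrite mul1r hornerM hornerXn normrM (ger0_norm (sqr_ge0 _)).
rewrite normrM (ger0_norm (expR_ge0 _)) expRN => h.
rewrite -ler_pdivlMr ?expR_gt0 ?invr_gt0 ?expR_gt0// invrK.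
rewrite -(ler_pM2l (_ : 0 < y^-1 ^+ 2)) ?exprn_gt0//.
apply: le_trans h _; rewrite le_eqVlt; apply/orP; left; apply/eqP.
by field; exact: lt0r_neq0.
Qed.

Lemma is_derive_flat p y : is_derive y 1 (flat p) (flat ('X ^+ 2 * (p - p^`())) y).
Proof.
have [y0|y0|->] := ltgtP y 0.
- have -> : flat ('X ^+ 2 * (p - p^`())) y = 0 by rewrite /flat ltNge (ltW y0).
  apply: (@near_eq_is_derive _ _ _ (cst 0)).
  have : \forall z \near y, z < 0 by exact: lt_nbhsl.
  by apply: filterS => z z0; rewrite /flat ltNge (ltW z0).
- have -> : flat ('X ^+ 2 * (p - p^`())) y =
    ('X ^+ 2 * (p - p^`())).[y^-1] * expR (- y^-1) by rewrite /flat y0.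
  have dinv : is_derive (y : R) 1 (fun z : R => z^-1) (- y ^- 2 *: 1).
    by apply: is_deriveV; exact: lt0r_neq0.
  have dp := is_derive_comp (is_derive_poly p y^-1) dinv.
  have de := @is_derive_comp _ _ expR (fun z => - 1 * z^-1) _ _ _ _
    (is_derive_expR (- 1 * y^-1)) (is_derive_scale (- 1) dinv).
  apply: near_eq_is_derive (is_derive_eq (is_derive_mul dp de) _).
    have : \forall z \near y, 0 < z by exact: lt_nbhsr.
    by apply: filterS => z z0; rewrite /flat z0 mulN1r.
  rewrite hornerM hornerXn hornerD hornerN mulN1r /GRing.scale /=.
  by field; exact: lt0r_neq0.
- have -> : flat ('X ^+ 2 * (p - p^`())) 0 = 0 by rewrite /flat ltxx.
  have [C C0 hC] := flat_sqr_bound p.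
  have lim0 : (fun h : R => h^-1 *: ((flat p \o shift 0) (h *: 1) - flat p 0)) @ 0^' --> (0 : R).
    apply/cvgr0Pnorm_lt => e e0; near=> h.
    have h0 : h != 0 by near: h; exact: nbhs_dnbhs_neq.
    rewrite /= /flat ltxx subr0 addr0 -/(flat p _) /GRing.scale /= mulr1 normrM normfV.
    rewrite mulrC ltr_pdivrMr ?normr_gt0//.
    apply: le_lt_trans (hC h) _; rewrite -real_normK ?num_real// expr2 mulrA.
    rewrite ltr_pM2r ?normr_gt0//.
    have : `|h| < e / (C + 1).
      by near: h; apply: dnbhs0_lt; rewrite divr_gt0// ltr_pwDr.
    rewrite ltr_pdivlMr ?ltr_pwDr//; have := normr_ge0 h; nra.
  by split; [apply/cvg_ex; exists 0|exact: cvg_lim].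
Unshelve. all: by end_near. Qed.

Lemma Ck_flatexp n k (U : set 'rV[R]_n) g : open U -> Ck k U g ->
  Ck k U (fun x => flatexp (g x)).
Proof.
move=> oU; apply: (@Ck_comp _ _ _ _ setT [set flat p | p in setT]) => //.
- move=> _ [p _ <-] y _; apply: differentiable_continuous.
  by apply/derivable1_diffP; have [] := is_derive_flat p y.
- move=> _ [p _ <-]; exists (flat ('X ^+ 2 * (p - p^`()))); first by eexists.
  by move=> y _; exact: is_derive_flat.
Qed.

Lemma flatexp0 y : y <= 0 -> flatexp y = 0.
Proof. by move=> y0; rewrite /flatexp /flat ltNge y0. Qed.

Lemma flatexpE y : 0 < y -> flatexp y = expR (- y^-1).
Proof. by move=> y0; rewrite /flatexp /flat y0 hornerC mul1r. Qed.

Lemma flatexp_gt0 y : (0 < flatexp y) = (0 < y).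
Proof.
by have [y0|y0] := leP y 0; [rewrite flatexp0// ltxx|rewrite flatexpE// expR_gt0].
Qed.

Lemma is_derive_flatexp y : 0 < y -> is_derive y 1 flatexp (y ^- 2 * flatexp y).
Proof.
move=> y0; apply: is_derive_eq (is_derive_flat 1%:P y) _.
rewrite flatexpE// /flat y0 derivC subr0 mulr1 hornerXn exprVn.
by [].
Qed.

End flatexp.

Section polar.
Variables (R : realType) (n : nat).
Local Notation Rn := 'rV[R]_n.+1.
Implicit Types (x : Rn) (i : 'I_n.+1).
Local Notation N := (n.+1%:R : R).

(** Twice the logarithm of |x|; since ln 0 = 0, this is 0 at the origin. *)
Definition logr x : R := ln (sqnorm x).
(** The cosine of the angle with the axis: x_N / |x| written with exp and ln, which
makes its smoothness off the origin immediate; it is 0 at the origin. *)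
Definition cosangle x : R := x 0 ord_max * expR (- (1 / 2) * logr x).

Lemma open_neq0 : open [set x : Rn | x != 0].
Proof.
rewrite (_ : [set x | _] = sqnorm (n := n.+1) @^-1` [set y | y != 0]).
  apply: open_comp; last exact: open_neq.
  by move=> x _; apply: (Ck_continuous (Ck_sqnorm 0 openT)).
apply/seteqP; split=> x /=; first by move=> /sqnorm_gt0/lt0r_neq0.
apply: contra => /eqP ->; rewrite /sqnorm big1// => i _.
by rewrite mxE expr0n.
Qed.

Lemma Ck_logr k : Ck k [set x : Rn | x != 0] logr.
Proof.
apply: Ck_ln; [exact: open_neq0|by move=> x; exact: sqnorm_gt0|].
exact/Ck_sqnorm/open_neq0.
Qed.

Lemma Ck_cosangle k : Ck k [set x : Rn | x != 0] cosangle.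
Proof.
have o := open_neq0.
by apply: CkM => //; [exact: Ck_coord|apply/Ck_expR/CkZ/Ck_logr].
Qed.

Lemma expR_logr x : x != 0 -> expR (- (1 / 2) * logr x) = (enorm x)^-1.
Proof.
move=> x0; have q0 := sqnorm_gt0 x0.
have e0 : 0 < enorm x by rewrite sqrtr_gt0.
apply: (@pexpIrn _ 2) => //; rewrite ?nnegrE ?expR_ge0 ?invr_ge0 ?(ltW e0)//.
rewrite expr2 -expRD exprVn sqr_enorm.
have -> : - (1 / 2) * logr x + - (1 / 2) * logr x = - logr x by lra.
by rewrite expRN lnK.
Qed.

Lemma cosangleE x : x != 0 -> cosangle x = x 0 ord_max / enorm x.
Proof. by move=> x0; rewrite /cosangle expR_logr. Qed.

Lemma sqr_cosangle_le1 x : cosangle x ^+ 2 <= 1.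
Proof.
have [->|x0] := eqVneq x 0.
  by rewrite /cosangle mxE mul0r expr0n.
rewrite cosangleE// exprMn exprVn sqr_enorm ler_pdivrMr ?sqnorm_gt0// mul1r.
exact: sqr_coord_le.
Qed.

Lemma is_derive_sqnorm x i :
  is_derive x (delta_mx 0 i) (@sqnorm R n.+1) (2 * x 0 i).
Proof.
have h := @is_derive_sum _ _ _ n.+1 (fun j (y : Rn) => y 0 j ^+ 2) x (delta_mx 0 i)
  (fun j => 2 * x 0 i * (j == i)%:R).
rewrite (_ : @sqnorm _ _ = \sum_(j < n.+1) (fun y : Rn => y 0 j ^+ 2)); last first.
  by apply/funext => y; rewrite fct_sumE.
apply: (is_derive_eq (h _)) => [j|].
  rewrite (_ : (fun y : Rn => _) = fun y => y 0 j * y 0 j); last first.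
    by apply/funext => y; rewrite expr2.
  apply: (is_derive_eq (is_derive_mul (is_derive_coord _ _ _) (is_derive_coord _ _ _))).
  by have [->|] := eqVneq j i; rewrite ?mulr1 ?mulr0 ?mul0r ?addr0//=; ring.
rewrite -mulr_sumr (bigD1 i)//= eqxx big1 ?addr0 ?mulr1// => j /negbTE ->//.
Qed.

Lemma is_derive_logr x i : x != 0 ->
  is_derive x (delta_mx 0 i) logr (2 * x 0 i * (sqnorm x)^-1).
Proof.
move=> x0; apply: is_derive_eq
  (is_derive_comp (is_derive1_ln (sqnorm_gt0 x0)) (is_derive_sqnorm x i)) _.
by rewrite mulrC.
Qed.

Lemma is_derive_inv_sqnorm x i : x != 0 ->
  is_derive x (delta_mx 0 i) (fun y => (sqnorm y)^-1) (- 2 * x 0 i * (sqnorm x)^- 2).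
Proof.
move=> x0; have q0 := sqnorm_gt0 x0.
have dinv : is_derive (sqnorm x) 1 (fun z : R => z^-1) (- (sqnorm x) ^- 2 *: 1).
  by apply: is_deriveV; exact: lt0r_neq0.
apply: is_derive_eq (is_derive_comp dinv (is_derive_sqnorm x i)) _.
by rewrite /GRing.scale /=; ring.
Qed.

Lemma is_derive_expR_logr x i : x != 0 ->
  is_derive x (delta_mx 0 i) (fun y => expR (- (1 / 2) * logr y))
    (- expR (- (1 / 2) * logr x) * x 0 i * (sqnorm x)^-1).
Proof.
move=> x0; apply: is_derive_eq (is_derive_comp (is_derive_expR _)
  (is_derive_scale _ (is_derive_logr i x0))) _.
by field; exact: lt0r_neq0 (sqnorm_gt0 x0).
Qed.

Lemma is_derive_cosangle x i : x != 0 ->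
  is_derive x (delta_mx 0 i) cosangle
   ((ord_max == i)%:R * expR (- (1 / 2) * logr x) - cosangle x * x 0 i * (sqnorm x)^-1).
Proof.
move=> x0; apply: is_derive_eq (is_derive_mul (is_derive_coord i ord_max x)
  (is_derive_expR_logr i x0)) _.
by rewrite /cosangle; ring.
Qed.

(** With r = 1/|x|^2, the gradients of L = [logr] and t = [cosangle] satisfy
|grad L|^2 = 4 r, grad L . grad t = 0, |grad t|^2 = (1 - t^2) r,
Delta L = 2 (N - 2) r and Delta t = - (N - 1) t r. *)
Theorem laplacian_polar (W : set Rn) (P P1 P2 f f1 f2 : R -> R) x :
  open W -> (forall x, W x -> x != 0) ->
  (forall x, W x -> is_derive (logr x) 1 P (P1 (logr x)) /\
                    is_derive (logr x) 1 P1 (P2 (logr x))) ->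
  (forall x, W x -> is_derive (cosangle x) 1 f (f1 (cosangle x)) /\
                    is_derive (cosangle x) 1 f1 (f2 (cosangle x))) ->
  W x ->
  laplacian (fun x => P (logr x) * f (cosangle x)) x =
  ((4 * P2 (logr x) + 2 * (N - 2) * P1 (logr x)) * f (cosangle x) +
   P (logr x) * ((1 - cosangle x ^+ 2) * f2 (cosangle x) -
                 (N - 1) * cosangle x * f1 (cosangle x))) / sqnorm x.
Proof.
move=> oW W0 dP df Wx.
pose w x := P (logr x) * f (cosangle x).
pose S x := expR (- (1 / 2) * logr x).
pose D i x := (ord_max == i)%:R * S x - cosangle x * x 0 i * (sqnorm x)^-1.
pose g i x := P1 (logr x) * (2 * x 0 i * (sqnorm x)^-1) * f (cosangle x) +
  P (logr x) * (f1 (cosangle x) * D i x).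
have dw i y : W y -> is_derive y (delta_mx 0 i) w (g i y).
  move=> Wy; have y0 := W0 _ Wy; have [dP1 _] := dP _ Wy; have [df1 _] := df _ Wy.
  exact: is_derive_mul (is_derive_comp dP1 (is_derive_logr i y0))
    (is_derive_comp df1 (is_derive_cosangle i y0)).
have x0 := W0 _ Wx; have [dPx dP1x] := dP _ Wx; have [dfx df1x] := df _ Wx.
have q0 := sqnorm_gt0 x0.
pose r := (sqnorm x)^-1; pose s := S x; pose t := cosangle x.
have s2 : s ^+ 2 = r by rewrite /s /S expR_logr// exprVn sqr_enorm.
have ts : t = x 0 ord_max * s by [].
(* The pure second derivatives are A + B x_i^2 + C [i = N] + E [i = N] x_i, and
   the sums over i of 1, x_i^2, [i = N], [i = N] x_i are N, |x|^2, 1, x_N. The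
   coefficients are kept opaque to protect them from the splitting of sums. *)
have [A AE] : exists A, A = 2 * P1 (logr x) * r * f t - P (logr x) * f1 t * t * r.
  by eexists.
have [B BE] : exists B, B =
    4 * P2 (logr x) * r ^+ 2 * f t - 4 * P1 (logr x) * f1 t * t * r ^+ 2
    - 4 * P1 (logr x) * r ^+ 2 * f t + P (logr x) * f2 t * t ^+ 2 * r ^+ 2
    + 3 * P (logr x) * f1 t * t * r ^+ 2.
  by eexists.
have [C CE] : exists C, C = P (logr x) * f2 t * r by eexists.
have [E EE] : exists E, E = 4 * P1 (logr x) * f1 t * s * r
    - 2 * P (logr x) * f2 t * s * t * r - 2 * P (logr x) * f1 t * s * r.
  by eexists.
have ddw i : partial i (partial i w) x =
    A + B * x 0 i ^+ 2 + C * (ord_max == i)%:R + E * ((ord_max == i)%:R * x 0 i).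
  have -> : partial i (partial i w) x = partial i (g i) x.
    apply: near_eq_derive; apply: filterS (open_nbhs_nbhs (conj oW Wx)) => y Wy.
    exact: (derive_val (is_derive := dw i y Wy)).
  have dx := is_derive_coord i i x; rewrite eqxx in dx.
  have dr := is_derive_inv_sqnorm i x0.
  have dlog := is_derive_logr i x0; have dcos := is_derive_cosangle i x0.
  have dD := is_derive_add (is_derive_scale (ord_max == i)%:R (is_derive_expR_logr i x0))
    (is_derive_scale (- 1) (is_derive_mul (is_derive_mul dcos dx) dr)).
  have dg := is_derive_add
    (is_derive_mul (is_derive_mul (is_derive_comp dP1x dlog)
       (is_derive_mul (is_derive_scale 2 dx) dr)) (is_derive_comp dfx dcos))
    (is_derive_mul (is_derive_comp dPx dlog) (is_derive_mul (is_derive_comp df1x dcos) dD)).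
  have gE : g i = fun y => P1 (logr y) * (2 * y 0 i * (sqnorm y)^-1) * f (cosangle y) +
      P (logr y) * (f1 (cosangle y) * ((ord_max == i)%:R * expR (- (1 / 2) * logr y) +
      - 1 * (cosangle y * y 0 i * (sqnorm y)^-1))).
    by apply/funext => y; rewrite /g /D /S mulN1r.
  rewrite gE; apply: etrans (derive_val (is_derive := dg)) _.
  rewrite -/t -/(S x) -/s -exprVn -/r AE BE CE EE -s2.
  by case: (ord_max == i); rewrite ?mulr1n ?mulr0n; ring.
rewrite /laplacian; under eq_bigr do rewrite ddw.
rewrite !big_split/= -!mulr_sumr sumr_const card_ord -/(sqnorm x).
have -> : \sum_(i < n.+1) (ord_max == i)%:R = 1 :> R.
  by rewrite (bigD1 ord_max)//= eqxx big1 ?addr0// => i; rewrite eq_sym => /negbTE ->.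
have -> : \sum_(i < n.+1) ((ord_max == i)%:R * x 0 i) = x 0 ord_max.
  rewrite (bigD1 ord_max)//= eqxx mul1r big1 ?addr0// => i.
  by rewrite eq_sym => /negbTE ->; rewrite mul0r.
have qr : sqnorm x = r^-1 by rewrite invrK.
have r0 : r != 0 by rewrite invr_eq0; exact: lt0r_neq0.
have -> : E * x 0 ord_max = (4 * P1 (logr x) * f1 t * r
    - 2 * P (logr x) * f2 t * t * r - 2 * P (logr x) * f1 t * r) * t.
  by rewrite EE ts; ring.
rewrite -mulr_natr qr AE BE CE -/t.
by field.
Qed.

End polar.

(** * A supersolution in cones slightly larger than the half-space *)

Section lower.
Variable R : realType.

(** With M = N - 1, the first eigenfunction t of the hemisphere is raised by 2c to
stay positive on t > -c; the concave correction - 2cM t^2 pays for the constant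
near t = 0, and the gap e pays for the correction near t = 1. The function
t + 2c - 2cM t^2 has derivatives 1 - 4cM t and - 4cM. *)
Lemma angular_supersolution (M e c t : R) : 0 <= M -> 0 < e <= 1 ->
  0 < c -> 4 * (3 + M) ^+ 2 * c = e -> - c <= t <= 1 ->
  0 < t + 2 * c - 2 * c * M * t ^+ 2 /\
  (M - e) * (t + 2 * c - 2 * c * M * t ^+ 2) <=
  (1 - t ^+ 2) * (4 * c * M) + M * t * (1 - 4 * c * M * t).
Proof.
move=> M0 /andP[e0 e1] c0 ce /andP[ct t1].
have Mc0 : 0 <= M * c by rewrite mulr_ge0// ltW.
have M2c0 : 0 <= M * (M * c) by rewrite mulr_ge0.
have cE : 36 * c + 24 * (M * c) + 4 * (M * (M * c)) = e by rewrite -ce; ring.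
have c136 : c <= 36^-1 by lra.
have Mc : M * c <= 24^-1 by lra.
have KM : 2 * ((3 + M) * (M * c)) <= e by lra.
have [t0|t0] := leP 0 t.
  have tt : t ^+ 2 <= t by rewrite expr2 ler_piMr.
  have tt0 : 0 <= t ^+ 2 by exact: sqr_ge0.
  have Mct : M * c * t ^+ 2 <= M * c * t by exact: ler_wpM2l.
  have Mct2 : M * c * t <= 24^-1 * t by exact: ler_wpM2r.
  split; first by lra.
  rewrite -subr_ge0.
  have -> : (1 - t ^+ 2) * (4 * c * M) + M * t * (1 - 4 * c * M * t) -
     (M - e) * (t + 2 * c - 2 * c * M * t ^+ 2) =
     e * t + 2 * (M * c) + 2 * (e * c) - 2 * ((2 + M + e) * (M * c)) * t ^+ 2 by ring.
  have h1 : 2 * ((2 + M + e) * (M * c)) <= e.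
    apply: le_trans KM; rewrite ler_pM2l// ler_wpM2r//; lra.
  have h0 : 0 <= (2 + M + e) * (M * c) by rewrite mulr_ge0//; lra.
  have h2 : 2 * ((2 + M + e) * (M * c)) * t ^+ 2 <= e * t by apply: ler_pM => //; lra.
  have : 0 <= e * c by rewrite mulr_ge0 ?ltW.
  lra.
have tc : t ^+ 2 <= c ^+ 2 by nra.
have tt0 : 0 <= t ^+ 2 by exact: sqr_ge0.
have Mct : M * c * t ^+ 2 <= M * c * c ^+ 2 by exact: ler_wpM2l.
have cc : c ^+ 2 <= 36^-1 * c by rewrite expr2 ler_wpM2r// ltW.
have Mcc : M * c * c ^+ 2 <= 24^-1 * (36^-1 * c).
  by apply: ler_pM => //; exact: sqr_ge0.
split; first by lra.
rewrite -subr_ge0.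
have -> : (1 - t ^+ 2) * (4 * c * M) + M * t * (1 - 4 * c * M * t) -
   (M - e) * (t + 2 * c - 2 * c * M * t ^+ 2) =
   e * t + 2 * (M * c) + 2 * (e * c) - 2 * (2 + M + e) * (M * c * t ^+ 2) by ring.
have h0 : 0 <= 2 + M + e by lra.
have h3 : (2 + M + e) * c ^+ 2 <= 1.
  have h4 : (2 + M + e) * c <= 1 by rewrite !mulrDl; nra.
  apply: le_trans h4; rewrite ler_wpM2l//; lra.
have h5 : (2 + M + e) * (M * c * t ^+ 2) <= M * c.
  apply: (@le_trans _ _ ((2 + M + e) * c ^+ 2 * (M * c))).
    rewrite [leRHS](_ : _ = (2 + M + e) * (M * c * c ^+ 2)); last by ring.
    exact: ler_wpM2l.
  by rewrite ler_piMl.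
have h6 : - (e * c) <= e * t by rewrite -mulrN ler_wpM2l// ltW.
have : 0 <= e * c by rewrite mulr_ge0 ?ltW.
lra.
Qed.

Variable n : nat.
Local Notation Rn := 'rV[R]_n.+1.
Local Notation N := (n.+1%:R : R).
Local Notation alpha := ((N - 2) / 2).

Lemma is_derive_expR_scale (a y : R) :
  is_derive y 1 (fun y => expR (a * y)) (a * expR (a * y)).
Proof.
apply: (is_derive_eq (@is_derive_comp _ _ expR (fun y => a * y) _ _ _ _
  (is_derive_expR _) (is_derive_scale a (is_derive_id y 1)))).
by rewrite mulr1 mulrC.
Qed.

(** The power |x|^(-alpha) contributes alpha^2 to the constant and the angular factor
N - 1 - e. *)
Lemma hardy_constant_lower (e : R) : (3 <= n.+1)%N -> 0 < e <= 1 ->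
  exists2 c : R, 0 < c & forall Omega : set Rn, open Omega ->
    (forall x, Omega x -> x != 0 /\ - c < cosangle x) ->
    ((N ^+ 2 / 4 - e)%:E <= hardy_constant Omega)%E.
Proof.
move=> N3 e01; have /andP[e0 e1] := e01.
have N3' : 3 <= N by rewrite ler_nat.
pose M := N - 1; have M0 : 0 <= M by rewrite /M; lra.
pose K := 4 * (3 + M) ^+ 2.
have K0 : 0 < K by rewrite mulr_gt0// exprn_gt0//; lra.
pose c := e / K; have c0 : 0 < c by exact: divr_gt0.
have Kc : K * c = e by rewrite mulrC divfK// lt0r_neq0.
exists c => // Omega oO hO.
have O0 x : Omega x -> x != 0 by move=> /hO[].
have k0 : 0 < N ^+ 2 / 4 - e.
  have : 9 <= N ^+ 2 by rewrite expr2; nra.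
  lra.
pose P (y : R) := expR (- (alpha / 2) * y).
pose f (t : R) := t + 2 * c - 2 * c * M * t ^+ 2.
pose w (x : Rn) := P (logr x) * f (cosangle x).
have tx x : Omega x -> - c <= cosangle x <= 1.
  move=> /hO[_ /ltW ->]/=; have := @sqr_cosangle_le1 R n x.
  by have [//|] := leP (cosangle x) 1; rewrite expr2; nra.
have fw x (Ox : Omega x) := angular_supersolution M0 e01 c0 Kc (tx _ Ox).
have Cw k : Ck k Omega w.
  have Cl : Ck k Omega (@logr R n) by apply: (Ck_sub _ (Ck_logr R n k)) => x /O0.
  have Ct : Ck k Omega (@cosangle R n).
    by apply: (Ck_sub _ (Ck_cosangle R n k)) => x /O0.
  apply: CkM => //; first by apply: Ck_expR => //; exact: CkZ.
  rewrite (_ : (fun x => f (cosangle x)) = fun x : Rn => (cosangle x + 2 * c) +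
    - (2 * c * M) * (cosangle x * cosangle x)); last first.
    by apply/funext => x; rewrite /f expr2 mulNr.
  apply: CkD => //; first by apply: CkD => //; exact: Ck_cst.
  by apply: CkZ => //; exact: CkM.
apply: hardy_constant_ge => // phi tphi.
apply: (supersolution_hardy oO O0 (ltW k0) (Cw 2) _ _ tphi).
- by move=> x Ox; rewrite /w mulr_gt0 ?expR_gt0//; case: (fw _ Ox).
- move=> x Ox.
  pose a := - (alpha / 2).
  rewrite (@laplacian_polar R n Omega P (fun y => a * P y) (fun y => a * (a * P y))
    f (fun t => 1 - 4 * c * M * t) (fun=> - (4 * c * M)))//; first last.
  + move=> y _; split.
      have h := is_derive_add (is_derive_add (is_derive_id (cosangle y) (1 : R))
        (is_derive_const (2 * c) _ _)) (is_derive_scale (- (2 * c * M))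
        (is_derive_mul (is_derive_id (cosangle y) (1 : R)) (is_derive_id _ _))).
      rewrite (_ : f = fun t => (t + 2 * c) + - (2 * c * M) * (t * t)); last first.
        by apply/funext => t; rewrite /f expr2 mulNr.
      by apply: is_derive_eq h _; rewrite /id; ring.
    have h := is_derive_add (is_derive_const 1 (cosangle y) (1 : R))
        (is_derive_scale (- (4 * c * M)) (is_derive_id (cosangle y) (1 : R))).
    rewrite (_ : (fun t => _) = fun t => 1 + - (4 * c * M) * t).
      by apply: (is_derive_eq h); rewrite /id add0r mulr1.
    by apply/funext => t; rewrite mulNr.
  + move=> y _; split; first exact: is_derive_expR_scale.
    exact: is_derive_scale (is_derive_expR_scale _ _).
  have q0 := sqnorm_gt0 (O0 _ Ox).
  rewrite [leRHS](_ : _ = - ((N ^+ 2 / 4 - e) * w x) / sqnorm x); last by ring.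
  rewrite ler_pM2r ?invr_gt0//.
  have [_ h] := fw _ Ox.
  rewrite /w -/(f (cosangle x)) in h *.
  have P0 : 0 < P (logr x) by exact: expR_gt0.
  rewrite -subr_ge0.
  have -> : - ((N ^+ 2 / 4 - e) * (P (logr x) * f (cosangle x))) -
    ((4 * (a * (a * P (logr x))) + 2 * (N - 2) * (a * P (logr x))) * f (cosangle x) +
     P (logr x) * ((1 - cosangle x ^+ 2) * - (4 * c * M) -
                   (N - 1) * cosangle x * (1 - 4 * c * M * cosangle x))) =
    P (logr x) * (((1 - cosangle x ^+ 2) * (4 * c * M) +
       M * cosangle x * (1 - 4 * c * M * cosangle x)) - (M - e) * f (cosangle x)).
    by rewrite /a /M; field.
  by rewrite mulr_ge0 ?subr_ge0// ltW.
Qed.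

End lower.

(** * A compactly supported subsolution in the half-space *)

Section upper.
Variable R : realType.

(** With M = N - 1 and u = 1/(t - d), the function f = (t - d) exp(-d / (t - d))
satisfies f' = (u + d u^2) f and f'' = d^2 u^4 f, so the right-hand side is
((1 - t^2) f'' - M t f') / f. Put z = d u. For z <= e / (3 (M + 1)) the error
M (2 z + z^2) is below e; for larger z the variable t is small, and the term in
z^2 u^2 dominates thanks to the choice of d. *)
Lemma angular_subsolution (M e d u : R) : 0 <= M -> 0 < e <= 1 ->
  d = (e / (3 * (M + 1))) ^+ 2 / (4 * (M + 1)) -> 0 < u -> (u^-1 + d) ^+ 2 <= 1 ->
  - (M + e) <= (1 - (u^-1 + d) ^+ 2) * (d ^+ 2 * u ^+ 4) -
    M * (u^-1 + d) * (u + d * u ^+ 2).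
Proof.
move=> M0 /andP[e0 e1]; set z0 := e / _ => dE u0 t1.
have z00 : 0 < z0 by rewrite divr_gt0//; lra.
have zE : 3 * (M + 1) * z0 = e by rewrite mulrC divfK//; apply: lt0r_neq0; lra.
have dE' : 4 * (M + 1) * d = z0 ^+ 2 by rewrite dE mulrC divfK//; apply: lt0r_neq0; lra.
have d0 : 0 < d by rewrite dE divr_gt0 ?exprn_gt0//; lra.
have z01 : z0 <= 1 / 3 by nra.
pose z := d * u; have z_gt0 : 0 < z by exact: mulr_gt0.
have -> : M * (u^-1 + d) * (u + d * u ^+ 2) = M * (1 + z) ^+ 2.
  by rewrite /z; field; exact: lt0r_neq0.
have -> : d ^+ 2 * u ^+ 4 = (z * u) ^+ 2 by rewrite /z; ring.
have [zz|zz] := leP z z0.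
  have h0 : 0 <= (1 - (u^-1 + d) ^+ 2) * (z * u) ^+ 2.
    by rewrite mulr_ge0 ?subr_ge0 ?sqr_ge0.
  have h1 : z ^+ 2 <= z by rewrite expr2 ler_piMr//; lra.
  have h2 : M * z ^+ 2 <= M * z by exact: ler_wpM2l.
  have h3 : M * z <= M * z0 by exact: ler_wpM2l.
  have -> : M * (1 + z) ^+ 2 = M + 2 * (M * z) + M * z ^+ 2 by ring.
  lra.
have zu : 4 * (M + 1) * z <= z0 ^+ 2 * u by rewrite -dE' /z mulrA.
have zu4 : 4 * (M + 1) <= z0 * u.
  rewrite -(ler_pM2l z00); apply: (@le_trans _ _ (4 * (M + 1) * z)).
    by rewrite mulrC ler_pM2l ?ltW//; lra.
  by rewrite [leRHS]mulrA -expr2.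
have u12 : 12 * (M + 1) <= u.
  have : z0 * u <= 1 / 3 * u by rewrite ler_wpM2r// ltW.
  lra.
have ui : u^-1 <= 12^-1.
  by rewrite lef_pV2 ?posrE//; lra.
have ui0 : 0 < u^-1 by rewrite invr_gt0.
have d36 : d <= 1 / 36.
  have : z0 ^+ 2 <= 1 / 9 by rewrite expr2; nra.
  have : 0 <= M * d by rewrite mulr_ge0// ltW.
  lra.
have t2 : (u^-1 + d) ^+ 2 <= 1 / 4 by rewrite expr2; nra.
have h1 : 4 * (M + 1) <= z * u.
  by apply: le_trans zu4 _; rewrite ler_wpM2r// ltW.
have h2 : 12 * (M + 1) * z <= z * u by rewrite mulrC ler_wpM2l// ltW.
have h3 : 4 * (M + 1) * (12 * (M + 1) * z) <= (z * u) ^+ 2.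
  by rewrite expr2; apply: ler_pM => //; rewrite !mulr_ge0//; lra.
have h4 : (12 * (M + 1) * z) ^+ 2 <= (z * u) ^+ 2.
  rewrite !expr2; apply: ler_pM => //; rewrite !mulr_ge0//; lra.
have h5 : 1 / 2 * (z * u) ^+ 2 <= (1 - (u^-1 + d) ^+ 2) * (z * u) ^+ 2.
  by rewrite ler_wpM2r ?sqr_ge0//; lra.
have Mz : 0 <= M * z by rewrite mulr_ge0// ltW.
have MMz : 0 <= M * (M * z) by rewrite mulr_ge0.
have Mzz : 0 <= M * z ^+ 2 by rewrite mulr_ge0// sqr_ge0.
have MMzz : 0 <= M * (M * z ^+ 2) by rewrite mulr_ge0.
have zz0 : 0 <= z ^+ 2 by exact: sqr_ge0.
have h3' : 48 * (M * (M * z)) + 96 * (M * z) + 48 * z <= (z * u) ^+ 2.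
  by apply: le_trans h3; rewrite le_eqVlt; apply/orP; left; apply/eqP; ring.
have h4' : 144 * (M * (M * z ^+ 2)) + 288 * (M * z ^+ 2) + 144 * z ^+ 2 <= (z * u) ^+ 2.
  by apply: le_trans h4; rewrite le_eqVlt; apply/orP; left; apply/eqP; ring.
have -> : M * (1 + z) ^+ 2 = M + 2 * (M * z) + M * z ^+ 2 by ring.
lra.
Qed.

(** With p = 1 / (1 - b y^2) one has b y^2 = 1 - 1/p, and the right-hand side becomes
4 b (4 p^4 - 12 p^3 + 6 p^2), where
4 p^4 - 12 p^3 + 6 p^2 + 10 = (2 p^2 - 3 p - 1)^2 + (p - 3)^2. *)
Lemma radial_subsolution (b y p : R) : 0 < b -> p * (1 - b * y ^+ 2) = 1 ->
  - (40 * b) <= 4 * (- 2 * b * y * p ^+ 2) ^+ 2 +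
     4 * (- 2 * b * p ^+ 2 - 8 * b ^+ 2 * y ^+ 2 * p ^+ 3).
Proof.
move=> b0 pE; have byp : b * y ^+ 2 * p = p - 1 by rewrite -[X in _ - X]pE; ring.
have -> : 4 * (- 2 * b * y * p ^+ 2) ^+ 2 +
     4 * (- 2 * b * p ^+ 2 - 8 * b ^+ 2 * y ^+ 2 * p ^+ 3) =
   b * (16 * (b * y ^+ 2 * p) * p ^+ 3 - 8 * p ^+ 2 - 32 * (b * y ^+ 2 * p) * p ^+ 2).
  by ring.
rewrite byp -subr_ge0 [X in 0 <= X](_ : _ =
  b * (4 * ((2 * p ^+ 2 - 3 * p - 1) ^+ 2 + (p - 3) ^+ 2))); last by ring.
apply: mulr_ge0; first exact: ltW.
by apply: mulr_ge0 => //; apply: addr_ge0; exact: sqr_ge0.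
Qed.

Lemma is_derive_flatexp_comp (g : R -> R) (y dg : R) : 0 < g y ->
  is_derive y 1 g dg ->
  is_derive y 1 (fun y => flatexp (g y)) (dg * (g y)^-1 ^+ 2 * flatexp (g y)).
Proof.
move=> g0 dgy; apply: is_derive_eq (is_derive_comp (is_derive_flatexp g0) dgy) _.
by rewrite exprVn; ring.
Qed.

Lemma is_derive_inv (g : R -> R) (y dg : R) : 0 < g y ->
  is_derive y 1 g dg -> is_derive y 1 (fun y => (g y)^-1) (- dg * (g y)^-1 ^+ 2).
Proof.
move=> g0 dgy; have gn0 := lt0r_neq0 g0.
apply: is_derive_eq (is_deriveV gn0 dgy) _.
by rewrite /GRing.scale/= exprVn; ring.
Qed.

Lemma is_derive_sub_sqr (b y : R) :
  is_derive y 1 (fun y => 1 - b * y ^+ 2) (- 2 * b * y).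
Proof.
have h := is_derive_add (is_derive_const 1 y (1 : R)) (is_derive_scale (- b)
  (is_derive_mul (is_derive_id y (1 : R)) (is_derive_id _ _))).
rewrite (_ : (fun y => _) = fun y => 1 + - b * (y * y)).
  by apply: is_derive_eq h _; rewrite /id; ring.
by apply/funext => t; rewrite expr2 mulNr.
Qed.

Definition radial (a b y : R) := expR (a * y) * flatexp (1 - b * y ^+ 2).

(** The logarithmic derivative of [radial]. *)
Definition dlog_radial (a b y : R) := a + - 2 * b * y * (1 - b * y ^+ 2)^-1 ^+ 2.

Lemma is_derive_radial (a b y : R) : 0 < 1 - b * y ^+ 2 ->
  is_derive y 1 (radial a b) (dlog_radial a b y * radial a b y).
Proof.
move=> y0; have h := @is_derive_flatexp_comp (fun y => 1 - b * y ^+ 2) y _ y0 (is_derive_sub_sqr b y).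
apply: is_derive_eq (is_derive_mul (is_derive_expR_scale a y) h) _.
by rewrite /dlog_radial /radial; ring.
Qed.

Lemma is_derive_radial2 (a b y : R) : 0 < 1 - b * y ^+ 2 ->
  is_derive y 1 (fun y => dlog_radial a b y * radial a b y)
   ((dlog_radial a b y ^+ 2 + - 2 * b * (1 - b * y ^+ 2)^-1 ^+ 2
     - 8 * b ^+ 2 * y ^+ 2 * (1 - b * y ^+ 2)^-1 ^+ 3) * radial a b y).
Proof.
move=> y0; have di := @is_derive_inv (fun y => 1 - b * y ^+ 2) y _ y0 (is_derive_sub_sqr b y).
have h := is_derive_add (is_derive_const a y (1 : R))
  (is_derive_mul (is_derive_scale (- 2 * b) (is_derive_id y (1 : R)))
     (is_derive_mul di di)).
have dE : dlog_radial a b = fun y =>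
    a + - 2 * b * y * ((1 - b * y ^+ 2)^-1 * (1 - b * y ^+ 2)^-1).
  by apply/funext => t; rewrite /dlog_radial expr2.
have {}h : is_derive y 1 (dlog_radial a b) (- 2 * b * (1 - b * y ^+ 2)^-1 ^+ 2
     - 8 * b ^+ 2 * y ^+ 2 * (1 - b * y ^+ 2)^-1 ^+ 3).
  by rewrite dE; apply: is_derive_eq h _; rewrite /id; ring.
apply: is_derive_eq (is_derive_mul h (is_derive_radial a y0)) _.
by ring.
Qed.

(** The flat function is rescaled by d so that this is (t - d) exp(-d / (t - d)). *)
Definition angular (d t : R) := (t - d) * flatexp (d^-1 * (t - d)).

Definition angular1 (d t : R) := (1 + d * (t - d)^-1) * flatexp (d^-1 * (t - d)).

Definition angular2 (d t : R) := d ^+ 2 * (t - d)^-1 ^+ 3 * flatexp (d^-1 * (t - d)).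

Lemma is_derive_angular (d t : R) : 0 < d < t ->
  is_derive t 1 (angular d) (angular1 d t) /\
  is_derive t 1 (angular1 d) (angular2 d t).
Proof.
move=> /andP[d0 dt]; have td : 0 < t - d by rewrite subr_gt0.
have dsub : is_derive t 1 (fun t => t - d) 1.
  by apply: is_derive_eq (is_derive_add (is_derive_id t (1 : R))
    (is_derive_const (- d) _ _)) _; rewrite addr0.
have tdd : 0 < d^-1 * (t - d) by rewrite mulr_gt0 ?invr_gt0.
have db := @is_derive_flatexp_comp (fun t => d^-1 * (t - d)) t _ tdd (is_derive_scale d^-1 dsub).
have di := @is_derive_inv (fun t => t - d) t _ td dsub.
split.
  apply: is_derive_eq (is_derive_mul dsub db) _; rewrite /angular1.
  by field; rewrite !lt0r_neq0.
apply: is_derive_eq (is_derive_mul (is_derive_add (is_derive_const 1 t (1 : R))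
  (is_derive_scale d di)) db) _; rewrite /angular2.
by field; rewrite !lt0r_neq0.
Qed.

Lemma open_preimage (n : nat) (U : set 'rV[R]_n) (V : set R) g : open U -> open V ->
  (forall x, U x -> {for x, continuous g}) -> open (U `&` g @^-1` V).
Proof.
move=> oU oV cg; rewrite openE => x [Ux Vx]; apply: filterI.
  by apply: open_nbhs_nbhs.
by apply: (cg _ Ux); apply: open_nbhs_nbhs.
Qed.

Variable n : nat.
Local Notation Rn := 'rV[R]_n.+1.
Local Notation N := (n.+1%:R : R).
Local Notation alpha := ((N - 2) / 2).

(** The logarithm of |x|^2 is confined to b L^2 < 1, and b (1 + 1/b)^2 >= 1. *)
Lemma radial_support b (x : Rn) a : 0 < b -> x != 0 -> radial a b (logr x) != 0 ->
  expR (- (1 + b^-1)) <= sqnorm x <= expR (1 + b^-1).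
Proof.
move=> b0 x0 rx.
have : 0 < 1 - b * logr x ^+ 2.
  rewrite ltNge; apply: contra rx => h; rewrite /radial flatexp0 ?mulr0//.
have bi : 0 < b^-1 by rewrite invr_gt0.
have bb : b * b^-1 = 1 by rewrite divff// lt0r_neq0.
rewrite -[sqnorm x](lnK (sqnorm_gt0 x0 : _ \is Num.pos)) !ler_expR -/(logr x) => h.
have bK : 1 <= b * (1 + b^-1) ^+ 2.
  rewrite (_ : b * (1 + b^-1) ^+ 2 = b + 2 * (b * b^-1) + b * b^-1 * b^-1); last by ring.
  by rewrite bb; lra.
have hL : logr x ^+ 2 <= (1 + b^-1) ^+ 2.
  by rewrite -(ler_pM2l b0); lra.
by rewrite -ler_norml -ler_sqr ?nnegrE// ?real_normK ?num_real//; lra.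
Qed.

(** On its positivity set the product of the radial and angular factors satisfies
- Delta phi <= (alpha^2 + 40 b + (N - 1) + e) phi / |x|^2, with 40 b = e. *)
Lemma hardy_constant_upper (e : R) : 0 < e <= 1 ->
  exists2 d : R, 0 < d & forall Omega : set Rn, open Omega ->
    (forall x, Omega x -> x != 0) ->
    (forall x, x != 0 -> d <= cosangle x -> Omega x) ->
    (hardy_constant Omega <= (N ^+ 2 / 4 + 2 * e)%:E)%E.
Proof.
move=> e01; have /andP[e0 e1] := e01.
pose M := N - 1; have M0 : 0 <= M by rewrite /M subr_ge0 ler1n.
pose z0 := e / (3 * (M + 1)).
have z00 : 0 < z0 by rewrite divr_gt0//; lra.
have z01 : z0 <= 1.
  by rewrite ler_pdivrMr; lra.
pose d := z0 ^+ 2 / (4 * (M + 1)).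
have d0 : 0 < d by rewrite divr_gt0 ?exprn_gt0//; lra.
have d1 : d < 1.
  rewrite ltr_pdivrMr; last by lra.
  have : z0 ^+ 2 <= 1 by rewrite expr2; nra.
  lra.
exists d => // Omega oO O0 sO.
pose b := e / 40; have b0 : 0 < b by rewrite divr_gt0.
have be : 40 * b = e by rewrite /b; field.
pose a := - (alpha / 2).
pose phi (x : Rn) := radial a b (logr x) * angular d (cosangle x).
have phi_neq0 x : phi x != 0 -> [/\ x != 0, radial a b (logr x) != 0 & d < cosangle x].
  rewrite /phi mulf_eq0 negb_or => /andP[rx]; rewrite mulf_eq0 negb_or => /andP[tx bx].
  have dt : d < cosangle x.
    rewrite ltNge; apply: contra bx => td; rewrite flatexp0//.
    by rewrite pmulr_rle0 ?invr_gt0// subr_le0.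
  split=> //; apply/eqP => x0; move: dt.
  by rewrite x0 /cosangle mxE mul0r ltNge ltW.
pose K := 1 + b^-1.
have phi_supp x : phi x != 0 -> expR (- K) <= sqnorm x <= expR K.
  by move=> /phi_neq0[x0 rx _]; exact: radial_support rx.
have U0o := @open_neq0 R n.
have C0 k : Ck k setT phi.
  (* Near the origin the radial factor vanishes, because L tends to -oo; at the
     origin itself it is the angular factor that vanishes, since t = 0 < d. *)
  pose Z := [set x : Rn | sqnorm x < expR (- K)].
  have oZ : open Z.
    rewrite (_ : Z = @sqnorm R n.+1 @^-1` [set y | y < expR (- K)])//.
    apply: open_comp; last exact: open_lt.
    by move=> x _; apply: (Ck_continuous (Ck_sqnorm 0 openT)).
  rewrite (_ : setT = [set x : Rn | x != 0] `|` Z); last first.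
    apply/seteqP; split=> // x _; have [->|x0] := eqVneq x 0; last by left.
    right; rewrite /Z/= /sqnorm big1 ?expR_gt0// => i _.
    by rewrite mxE expr0n.
  have Cl := Ck_logr R n k; have Cc := Ck_cosangle R n k.
  apply: Ck_union.
    apply: CkM => //.
      apply: CkM => //; first by apply: Ck_expR => //; exact: CkZ.
      apply: Ck_flatexp => //.
      rewrite (_ : (fun x => _) = fun x : Rn => 1 + - b * (logr x * logr x)); last first.
        by apply/funext => x; rewrite expr2 mulNr.
      by apply: CkD => //; [exact: Ck_cst|apply: CkZ => //; exact: CkM].
    have Cs : Ck k [set x : Rn | x != 0] (fun x => cosangle x - d).
      by apply: CkD => //; exact: Ck_cst.
    by apply: CkM => //; apply: Ck_flatexp => //; exact: CkZ.
  apply: (@eq_Ck _ _ _ _ (fun=> 0)) => //; last exact: Ck_cst.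
  move=> x; rewrite /Z/= => Zx; apply/esym/eqP; apply: contraTT Zx => /phi_supp.
  by move=> /andP[h _]; rewrite -leNgt.
pose C := [set x : Rn | expR (- K) <= sqnorm x] `&`
  ([set x : Rn | sqnorm x <= expR K] `&` [set x : Rn | 0 <= x 0 ord_max - d * enorm x]).
have csq := Ck_continuousT (Ck_sqnorm (R:=R) (n:=n.+1) 0 openT).
have cdist : continuous (fun x : Rn => x 0 ord_max - d * enorm x).
  move=> x; apply: (@continuousB _ _ _ (fun x : Rn => x 0 ord_max) (fun x => d * enorm x)).
    exact: coord_continuous.
  apply: (@continuousM _ _ (fun=> d) (@enorm R n.+1)); first exact: cst_continuous.
  by apply: continuous_comp; [exact: csq|exact: sqrt_continuous].
have cC : closed C.
  apply: closedI; last apply: closedI.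
  - by apply: (@closed_comp _ _ (@sqnorm R n.+1) [set y | expR (- K) <= y]);
      [move=> x _; exact: csq|exact: closed_ge].
  - by apply: (@closed_comp _ _ (@sqnorm R n.+1) [set y | y <= expR K]);
      [move=> x _; exact: csq|exact: closed_le].
  - apply: (@closed_comp _ _ (fun x : Rn => x 0 ord_max - d * enorm x) [set y | 0 <= y]);
      last exact: closed_ge.
    by move=> x _; exact: cdist.
have sC : closure [set x | phi x != 0] `<=` C.
  rewrite [X in _ `<=` X](closure_id C).1//; apply: closure_subset => x /= phix.
  have /andP[q1 q2] := phi_supp _ phix; have [x0 _ dx] := phi_neq0 _ phix.
  do 2 split=> //=; rewrite subr_ge0 -ler_pdivlMr; first by rewrite -cosangleE// ltW.
  by rewrite sqrtr_gt0; exact: sqnorm_gt0.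
have CO : C `<=` Omega.
  move=> x [/= q1 [/= _ ]]; have q0 : 0 < sqnorm x := lt_le_trans (expR_gt0 _) q1.
  have x0 : x != 0.
    apply: contraTneq q0 => ->; rewrite /sqnorm big1 ?ltxx// => i _.
    by rewrite mxE expr0n.
  by rewrite subr_ge0 -ler_pdivlMr ?sqrtr_gt0// -cosangleE// => dx; exact: sO.
have tphi : test_function Omega phi.
  split; first exact: Ck_smooth.
    apply: bounded_closed_compact; last exact: closed_closure.
    exists (expR K + 1); split; first exact: num_real.
    move=> B KB x /sC[_ [/= qK _]]; apply/ltW.
    have B0 : 0 < B by apply: le_lt_trans KB; rewrite addr_ge0 ?expR_ge0.
    have := rV_ballE 0 x B0; rewrite mx_norm_ball /ball_/= sub0r normrN => -[_]; apply.
    move=> j; rewrite mxE sub0r normrN; apply: le_lt_trans KB.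
    have := le_trans (sqr_coord_le x j) qK; rewrite -real_normK ?num_real//.
    have := expR_gt0 K; have := normr_ge0 (x 0 j); rewrite expr2; nra.
  exact: subset_trans CO.
apply: (hardy_constant_le oO O0 tphi).
  (* On the axis, at distance 1, one has L = 0 and t = 1. *)
  exists (delta_mx 0 ord_max).
  have q1 : sqnorm (delta_mx 0 ord_max : Rn) = 1.
    rewrite /sqnorm (bigD1 ord_max)//= mxE !eqxx expr1n big1 ?addr0// => i /negbTE h.
    by rewrite mxE h andbF expr0n.
  have l0 : logr (delta_mx 0 ord_max : Rn) = 0 by rewrite /logr q1 ln1.
  have c1 : cosangle (delta_mx 0 ord_max : Rn) = 1.
    by rewrite /cosangle l0 mulr0 expR0 mxE !eqxx mulr1.
  rewrite /phi l0 c1 !mulf_neq0 ?lt0r_neq0 ?expR_gt0 ?flatexp_gt0 ?subr_gt0//.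
    by rewrite expr0n mulr0.
  by rewrite mulr_gt0 ?invr_gt0 ?subr_gt0.
apply: subsolution_energy => //.
  by rewrite addr_ge0// ?mulr_ge0// ?invr_ge0 ?sqr_ge0// ltW.
move=> x Ox; have [phix|] := eqVneq (phi x) 0.
  by rewrite phix expr0n /= !(mul0r, mulr0) oppr0.
move=> phix; have [x0 rx dx] := phi_neq0 _ phix.
pose W := ([set x : Rn | x != 0] `&` @logr R n @^-1` [set y | 0 < 1 - b * y ^+ 2])
  `&` @cosangle R n @^-1` [set t | d < t].
have Wx : W x.
  split=> //; split=> //=; rewrite ltNge; apply: contra rx => h.
  by rewrite /radial flatexp0 ?mulr0.
have W0 y : W y -> y != 0 by case=> -[].
have oW : open W.
  apply: open_preimage; last 2 first.
  - exact: open_gt.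
  - by move=> y [y0 _]; exact: (Ck_continuous (Ck_cosangle R n 0)).
  apply: open_preimage => //; last by move=> y y0; exact: (Ck_continuous (Ck_logr R n 0)).
  rewrite (_ : [set y | _] = (fun y => 1 - b * y ^+ 2) @^-1` [set y | 0 < y])//.
  apply: open_comp; last exact: open_gt.
  move=> y _; apply: differentiable_continuous; apply/derivable1_diffP.
  by have [] := is_derive_sub_sqr b y.
have [[_ /= Lx] /= tx] := Wx.
have dR y : W y ->
    is_derive (logr y) 1 (radial a b) (dlog_radial a b (logr y) * radial a b (logr y)) /\
    is_derive (logr y) 1 (fun y => dlog_radial a b y * radial a b y)
      ((dlog_radial a b (logr y) ^+ 2 + - 2 * b * (1 - b * logr y ^+ 2)^-1 ^+ 2
        - 8 * b ^+ 2 * logr y ^+ 2 * (1 - b * logr y ^+ 2)^-1 ^+ 3) * radial a b (logr y)).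
  by move=> [[_ /= Ly] _]; split; [exact: is_derive_radial|exact: is_derive_radial2].
have dA y : W y ->
    is_derive (cosangle y) 1 (angular d) (angular1 d (cosangle y)) /\
    is_derive (cosangle y) 1 (angular1 d) (angular2 d (cosangle y)).
  by move=> [_ /= ty]; apply: is_derive_angular; rewrite d0.
have lap := @laplacian_polar R n W (radial a b) (fun y => dlog_radial a b y * radial a b y)
  (fun y => (dlog_radial a b y ^+ 2 + - 2 * b * (1 - b * y ^+ 2)^-1 ^+ 2
     - 8 * b ^+ 2 * y ^+ 2 * (1 - b * y ^+ 2)^-1 ^+ 3) * radial a b y)
  (angular d) (angular1 d) (angular2 d) x oW W0 dR dA Wx.
rewrite lap.
have q0 := sqnorm_gt0 x0.
set L := logr x in Lx *; set t := cosangle x in tx *.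
have td : 0 < t - d by rewrite subr_gt0.
pose u := (t - d)^-1; have u0 : 0 < u by rewrite invr_gt0.
have tE : u^-1 + d = t by rewrite invrK subrK.
have ang := @angular_subsolution M e d u M0 e01 erefl u0.
rewrite tE sqr_cosangle_le1 in ang; have {}ang := ang isT.
pose p := (1 - b * L ^+ 2)^-1.
have pE : p * (1 - b * L ^+ 2) = 1 by rewrite mulVf// lt0r_neq0.
have rad := radial_subsolution b0 pE; rewrite be in rad.
pose Q := 4 * (dlog_radial a b L ^+ 2 + - 2 * b * p ^+ 2 - 8 * b ^+ 2 * L ^+ 2 * p ^+ 3)
  + 2 * (N - 2) * dlog_radial a b L
  + ((1 - t ^+ 2) * (d ^+ 2 * u ^+ 4) - M * t * (u + d * u ^+ 2)).
have a1E : angular1 d t = (u + d * u ^+ 2) * angular d t.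
  by rewrite /angular1 /angular /u; field; exact: lt0r_neq0.
have a2E : angular2 d t = d ^+ 2 * u ^+ 4 * angular d t.
  by rewrite /angular2 /angular /u; field; exact: lt0r_neq0.
have QE : - (N ^+ 2 / 4 + 2 * e) <= Q.
  have -> : Q = (4 * (- 2 * b * L * p ^+ 2) ^+ 2 +
     4 * (- 2 * b * p ^+ 2 - 8 * b ^+ 2 * L ^+ 2 * p ^+ 3))
     + ((1 - t ^+ 2) * (d ^+ 2 * u ^+ 4) - M * t * (u + d * u ^+ 2)) - alpha ^+ 2.
    by rewrite /Q /dlog_radial -/p /a; field.
  have -> : N ^+ 2 / 4 = alpha ^+ 2 + M by rewrite /M; field.
  lra.
rewrite a1E a2E.
rewrite [leLHS](_ : _ = - Q * (phi x ^+ 2 / sqnorm x)); last first.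
  by rewrite /Q -/p /phi -/L -/t /M; ring.
rewrite ler_wpM2r//; last by rewrite lerNl.
by rewrite mulr_ge0 ?sqr_ge0// invr_ge0 ltW.
Qed.

End upper.

(** * Cones close to the half-space *)

Section cones.
Variables (R : realType) (n : nat).
Implicit Types (gamma e : R) (x : 'rV[R]_n.+1).

Lemma coneE gamma x :
  @cone R n gamma x <-> x != 0 /\ cos gamma < cosangle x.
Proof.
rewrite /cone/=; split=> -[x0 h]; split=> //; move: h.
  by rewrite cosangleE// ltr_pdivlMr 1?mulrC// sqrtr_gt0; exact: sqnorm_gt0.
by rewrite cosangleE// ltr_pdivlMr 1?mulrC// sqrtr_gt0; exact: sqnorm_gt0.
Qed.

Lemma open_cone gamma : open (@cone R n gamma).
Proof.
rewrite (_ : @cone R n gamma = [set x | x != 0] `&`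
    @cosangle R n @^-1` [set t | cos gamma < t]); last first.
  by apply/seteqP; split=> x /coneE.
apply: open_preimage; [exact: open_neq0|exact: open_gt|].
by move=> x x0; exact: (Ck_continuous (Ck_cosangle R n 0)).
Qed.

(** The lower bound asks for cos gamma > -c and the upper bound for cos gamma < d. *)
Theorem hardy_constant_cone e : (3 <= n.+1)%N -> 0 < e ->
  exists2 c : R, 0 < c & forall gamma, `|cos gamma| < c ->
    ((n.+1%:R ^+ 2 / 4 - e)%:E <= hardy_constant (@cone R n gamma) <=
     (n.+1%:R ^+ 2 / 4 + e)%:E)%E.
Proof.
move=> N3 e0; pose e' := Num.min 1 (e / 2).
have e'0 : 0 < e' by rewrite lt_min ltr01 divr_gt0.
have e'e : e' <= e / 2 by rewrite ge_min lexx orbT.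
have e'01 : 0 < e' <= 1 by rewrite e'0 ge_min lexx.
have [c c0 hc] := hardy_constant_lower N3 e'01.
have [d d0 hd] := hardy_constant_upper n e'01.
exists (Num.min c d) => [|gamma]; first by rewrite lt_min c0.
rewrite lt_min !ltr_norml => /andP[/andP[cc _] /andP[_ cd]].
apply/andP; split.
  apply: (@le_trans _ _ (n.+1%:R ^+ 2 / 4 - e')%:E); first by rewrite lee_fin; lra.
  apply: hc; first exact: open_cone.
  by move=> x /coneE[x0 xc]; split=> //; exact: lt_trans xc.
apply: (@le_trans _ _ (n.+1%:R ^+ 2 / 4 + 2 * e')%:E); last by rewrite lee_fin; lra.
apply: hd; first exact: open_cone.
  by move=> x [].
by move=> x x0 dx; apply/coneE; split=> //; exact: lt_le_trans dx.
Qed.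

End cones.

Theorem mainTheorem6 (R : realType) (n : nat) (hN : (3 <= n.+1)%N) :
  hardy_constant (@cone R n gamma) @[gamma --> (pi / 2)^'] -->
    hardy_constant (@cone R n (pi / 2)) /\
  hardy_constant (@cone R n (pi / 2)) = (n.+1%:R ^+ 2 / 4)%:E.
Proof.
have cos0 : cos (pi / 2) = 0 :> R by exact: cos_pihalf.
have hval : hardy_constant (@cone R n (pi / 2)) = (n.+1%:R ^+ 2 / 4)%:E.
  have bnd (e : R) : 0 < e -> ((n.+1%:R ^+ 2 / 4 - e)%:E <=
      hardy_constant (@cone R n (pi / 2)) <= (n.+1%:R ^+ 2 / 4 + e)%:E)%E.
    move=> e0; have [c c0] := hardy_constant_cone hN e0.
    by apply; rewrite cos0 normr0.
  apply/eqP; rewrite eq_le; apply/andP; split; apply/lee_addgt0Pr => e e0.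
    by rewrite -EFinD; case/andP: (bnd e e0).
  by have /andP[h _] := bnd e e0; rewrite -leeBlDr.
split=> //; rewrite hval; apply/fine_cvgP.
have near_cos (c : R) : 0 < c -> \forall gamma \near (pi / 2)^', `|cos gamma| < c.
  move=> c0; apply: cvg_within.
  have /cvgrPdist_lt/(_ c c0) := @continuous_cos R (pi / 2).
  by apply: filterS => y; rewrite cos0 sub0r normrN.
split.
  have [c c0 hc] := hardy_constant_cone hN (ltr01 : 0 < 1 :> R).
  apply: filterS (near_cos c c0) => gamma /hc /andP[h1 h2].
  by rewrite fin_numE -ltNye -ltey (lt_le_trans _ h1) ?ltNyr// (le_lt_trans h2) ?ltry.
apply/cvgrPdist_le => e e0; have [c c0 hc] := hardy_constant_cone hN e0.
apply: filterS (near_cos c c0) => gamma /hc /=.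
case: (hardy_constant _) => [h| |] /=; rewrite ?leye_eq ?leeNy_eq ?andbF//.
by rewrite !lee_fin => /andP[h1 h2]; rewrite ler_norml; apply/andP; split; lra.
Qed.
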